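(* Let $T$ be Richard Thompson's group, given by the finite presentation $$T=\langle x_0,x_1,c_1 \mid x_2^{x_1}=x_3,\ x_3^{x_1}=x_4,\ c_1=x_1c_2,\ c_2x_2=x_1c_3,\ c_1x_0=c_2^2,\ c_1^3=1\rangle ,$$ where $x_n$ denotes the word $x_0^{-(n-1)}x_1x_0^{n-1}$ and $c_n$ denotes the word $x_0^{-(n-1)}c_1x_1^{n-1}$ for $n\ge 2$. Then the Dehn function $\Phi_T$ of $T$ has a polynomial upper bound; more precisely $\Phi_T(n)\preccurlyeq n^5$.
   Context: Notation: $a^{b}=b^{-1}ab$, and a relation $u=v$ in a presentation stands for the relator $uv^{-1}$. Let $F_s$ be the free group on $a_1,\dots,a_s$, let $N$ be the normal closure in $F_s$ of relators $R_1,\dots,R_t$, and let $H=F_s/N$. For $w\in N$, the area of $w$ is $$\mathrm{Area}(w)=\min\Big\{k \,\Big|\, w=\prod_{i=1}^k U_i^{-1}R_{j_i}U_i \text{ in } F_s\Big\},\quad U_i\in F_s,\ R_{j_i}\in\{R_1,\dots,R_t\}^{\pm1}.$$ The Dehn function of the presentation is $\Phi(n)=\max\{\mathrm{Area}(w)\mid w\in N,\ |w|\le n\}$, where $|w|$ is the length of the word $w$. For non-decreasing functions $f,g:\mathbb N\to\mathbb N$, $f\preccurlyeq g$ means that there is a positive integer constant $C$ such that $f(n)\le C\,g(Cn)+Cn$ for all $n$. $\Phi_T$ denotes the Dehn function of the presentation of $T$ given in the claim (up to the equivalence $f\sim g \iff f\preccurlyeq g$ and $g\preccurlyeq f$, the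 Dehn function does not depend on the finite presentation). *)

(* Defs.v *)
From HB Require Import structures.
From mathcomp Require Import all_boot all_order.
From mathcomp Require Import boolp classical_sets.

Set Implicit Arguments.
Unset Strict Implicit.
Unset Printing Implicit Defensive.

Local Open Scope classical_set_scope.
Local Open Scope group_scope.

(* Free groups, realised on freely reduced words.  The letter (i, false) is   *)
(* the generator of index i and (i, true) is its inverse.                     *)

Notation letter s := ('I_s * bool)%type.

Definition linv s (a : letter s) : letter s := (a.1, ~~ a.2).

Definition reduced s (w : seq (letter s)) : bool :=
  sorted (fun a b => b != linv a) w.

Definition lpush s (a : letter s) (w : seq (letter s)) : seq (letter s) :=
  if w is b :: v then if b == linv a then v else a :: w else [:: a].

Definition reduce s (w : seq (letter s)) : seq (letter s) :=
  foldr (@lpush s) [::] w.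

Record freeGroup (s : nat) := FreeGroup {
  fgword :> seq (letter s);
  fgwordP : reduced fgword }.

HB.instance Definition _ s := [isSub for @fgword s].
HB.instance Definition _ s := [Choice of freeGroup s by <:].

Section FreeGroupTheory.
Variable s : nat.
Implicit Types (a b : letter s) (u v w : seq (letter s)).

Lemma linvK : involutive (@linv s).
Proof. by case=> i b; rewrite /linv /= negbK. Qed.

Lemma reduced_cons a w : reduced (a :: w) -> reduced w.
Proof. exact: path_sorted. Qed.

Lemma reduced_lpush a w : reduced w -> reduced (lpush a w).
Proof.
case: w => [//|b v] /= rbv; case: eqP => [_|/eqP ba].
  exact: path_sorted rbv.
by rewrite /= ba.
Qed.

Lemma reduced_reduce w : reduced (reduce w).
Proof. by elim: w => //= a w; apply: reduced_lpush. Qed.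

Lemma reduce_id w : reduced w -> reduce w = w.
Proof.
elim: w => //= a w IHw raw; rewrite IHw; last exact: path_sorted raw.
by case: w raw {IHw} => //= b v /andP[/negPf->].
Qed.

Lemma lpushK a w : reduced w -> lpush (linv a) (lpush a w) = w.
Proof.
case: w => [|b v] /= rbv; first by rewrite linvK eqxx.
case: eqP => [def_b|_] /=; last by rewrite linvK eqxx.
case: v rbv => [|c v] /=; first by rewrite def_b.
by rewrite def_b; case/andP=> /negPf->.
Qed.

Lemma reduce_lpush a w v :
  reduced w -> reduce (lpush a w ++ v) = lpush a (reduce (w ++ v)).
Proof.
case: w => //= b w rw; case: eqP => //= ->.
by have /= := @lpushK (linv a) _ (reduced_reduce (w ++ v)); rewrite linvK.
Qed.

Lemma reduce_catl u v : reduce (reduce u ++ v) = reduce (u ++ v).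
Proof.
by elim: u => //= a u IHu; rewrite reduce_lpush ?reduced_reduce ?IHu.
Qed.

Lemma reduce_catr u v : reduce (u ++ reduce v) = reduce (u ++ v).
Proof. by rewrite /reduce !foldr_cat -/(reduce v) -/(reduce _) reduce_id ?reduced_reduce. Qed.

Definition winv w := rev (map (@linv s) w).

Lemma reduced_winv w : reduced w -> reduced (winv w).
Proof.
rewrite /reduced /winv rev_sorted sorted_map; apply: sub_sorted => a b /=.
by apply: contra => /eqP/(can_inj linvK)->; rewrite linvK.
Qed.

Lemma reduce_winvl w : reduce (winv w ++ w) = [::].
Proof.
rewrite /winv; elim: w => //= a w IHw.
rewrite rev_cons -cats1 -catA /= -reduce_catr /=.
by rewrite lpushK ?reduced_reduce // reduce_catr.
Qed.

Lemma winvK : involutive winv.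
Proof. by move=> w; rewrite /winv map_rev revK (mapK linvK). Qed.

Definition fg_of (w : seq (letter s)) : freeGroup s :=
  FreeGroup (reduced_reduce w).

Definition fgone : freeGroup s := fg_of [::].
Definition fgmul (x y : freeGroup s) : freeGroup s := fg_of (x ++ y).
Definition fginv (x : freeGroup s) : freeGroup s :=
  FreeGroup (reduced_winv (fgwordP x)).

Lemma fgmulA : associative fgmul.
Proof. by move=> x y z; apply: val_inj; rewrite /= reduce_catl reduce_catr catA. Qed.
Lemma fgmul1 : left_id fgone fgmul.
Proof. by move=> x; apply: val_inj; rewrite /= reduce_id ?fgwordP. Qed.
Lemma fgmulr1 : right_id fgone fgmul.
Proof. by move=> x; apply: val_inj; rewrite /= cats0 reduce_id ?fgwordP. Qed.
Lemma fgmulV : left_inverse fgone fginv fgmul.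
Proof. by move=> x; apply: val_inj; rewrite /= reduce_winvl. Qed.
Lemma fgmulrV : right_inverse fgone fginv fgmul.
Proof.
by move=> x; apply: val_inj; rewrite /= -{1}[fgword x]winvK reduce_winvl.
Qed.

HB.instance Definition _ :=
  isGroup.Build (freeGroup s) fgmulA fgmul1 fgmulr1 fgmulV fgmulrV.

Definition fgen (i : 'I_s) : freeGroup s := fg_of [:: (i, false)].

End FreeGroupTheory.

(* The least and the greatest element of a set of naturals; the value is 0    *)
(* when there is none.                                                        *)

Definition nat_min (A : set nat) : nat := xget 0%N (A `&` lbound A).
Definition nat_max (A : set nat) : nat := xget 0%N (A `&` ubound A).

Lemma nat_minP (A : set nat) (k : nat) : A k ->
  A (nat_min A) /\ forall m, A m -> (nat_min A <= m)%N.
Proof.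
move=> Ak; rewrite /nat_min.
have exA : exists m, `[< A m >] by exists k; apply/asboolP.
suff /xgetPex : exists m, (A `&` lbound A) m by apply.
case: (ex_minnP exA) => m /asboolP Am minm.
by exists m; split=> // j Aj; apply: minm; apply/asboolP.
Qed.

Lemma nat_maxP (A : set nat) (k b : nat) : A k -> (forall m, A m -> (m <= b)%N) ->
  A (nat_max A) /\ forall m, A m -> (m <= nat_max A)%N.
Proof.
move=> Ak leAb; rewrite /nat_max.
have exA : exists m, `[< A m >] by exists k; apply/asboolP.
have bA m : `[< A m >] -> (m <= b)%N by move/asboolP/leAb.
suff /xgetPex : exists m, (A `&` ubound A) m by apply.
case: (ex_maxnP exA bA) => m /asboolP Am maxm.
by exists m; split=> // j Aj; apply: maxm; apply/asboolP.
Qed.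

Definition normal_subgroup (G : groupType) (N : set G) : Prop :=
  [/\ N 1, forall x y, N x -> N y -> N (x / y) & forall x y, N x -> N (x ^ y)].

Definition normal_closure (G : groupType) (R : set G) : set G :=
  smallest (@normal_subgroup G) R.

Section DehnFunction.
Variables (s : nat) (R : seq (freeGroup s)).

Definition relation_subgroup : set (freeGroup s) := normal_closure [set` R].

Definition conj_product (w : freeGroup s) (k : nat) : Prop :=
  exists U r : 'I_k -> freeGroup s,
    (forall i, r i \in R \/ (r i)^-1 \in R) /\
    w = \prod_(i < k) ((U i)^-1 * r i * U i).

Definition area (w : freeGroup s) : nat := nat_min [set k | conj_product w k].

(* [size w] is the length of the reduced word [w]. *)
Definition dehn (n : nat) : nat :=
  nat_max [set area w | w in [set w | relation_subgroup w /\ (size w <= n)%N]].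

(* The minimum in [area] and the maximum in [dehn] are attained. *)

Lemma conj_productM u v k l :
  conj_product u k -> conj_product v l -> conj_product (u * v) (k + l).
Proof.
move=> [U [r [rR ->]]] [V [t [tR ->]]].
pose cat (f : 'I_k -> freeGroup s) (g : 'I_l -> freeGroup s) (i : 'I_(k + l)) :=
  match split i with inl a => f a | inr b => g b end.
exists (cat U V), (cat r t); split=> [i|].
  by rewrite /cat; case: (split i).
rewrite big_split_ord /=; congr (_ * _); apply: eq_bigr => i _.
  by rewrite /cat -[lshift _ _]/(unsplit (inl i)) unsplitK.
by rewrite /cat -[rshift _ _]/(unsplit (inr i)) unsplitK.
Qed.

Lemma conj_product1 : conj_product 1 0.
Proof. by exists (fun=> 1), (fun=> 1); split=> [[]//|]; rewrite big_ord0. Qed.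

Lemma conj_product_rel r u : r \in R \/ r^-1 \in R ->
  conj_product (u^-1 * r * u) 1.
Proof.
by move=> rR; exists (fun=> u), (fun=> r); split=> //; rewrite big_ord1.
Qed.

Lemma conj_product_ind (P : freeGroup s -> Prop) : P 1 ->
    (forall u r w, r \in R \/ r^-1 \in R -> P w -> P (u^-1 * r * u * w)) ->
  forall w k, conj_product w k -> P w.
Proof.
move=> P1 PM w k [U [r [rR ->]]]; elim: k => [|k IHk] in U r rR *.
  by rewrite big_ord0.
rewrite big_ord_recl; apply: (PM) => //.
exact: (IHk (fun i => U (lift ord0 i)) (fun i => r (lift ord0 i))).
Qed.

Lemma normal_relation_subgroup : normal_subgroup relation_subgroup.
Proof.
split=> [N [[]//]|x y Nx Ny N RN|x y Nx N RN]; have [[N1 NB NJ] _] := RN.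
  by apply: NB; [apply: Nx | apply: Ny].
by apply: NJ; apply: Nx.
Qed.

Lemma relation_subgroupP w :
  relation_subgroup w <-> exists k, conj_product w k.
Proof.
split=> [/(_ [set w | exists k, conj_product w k])|[k]].
  apply; split; first split.
  - by exists 0%N; apply: conj_product1.
  - move=> x y [k Pk] [l Pl]; suff [m Pm] : exists m, conj_product y^-1 m.
      by exists (k + m)%N; apply: conj_productM.
    elim/conj_product_ind: Pl => [|u r v rR [m Pm]].
      by exists 0%N; rewrite invg1; apply: conj_product1.
    exists (m + 1)%N; rewrite invgM; apply: conj_productM => //.
    rewrite !invgM invgK mulgA; apply: conj_product_rel; rewrite invgK.
    by case: rR; [right|left].
  - move=> x y [k Pk]; elim/conj_product_ind: Pk => [|u r v rR [m Pm]].
      by exists 0%N; rewrite conj1g; apply: conj_product1.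
    exists (1 + m)%N; rewrite conjMg; apply: conj_productM => //.
    rewrite conjgE -!mulgA (mulgA _ u^-1) -invgM (mulgA _ r).
    exact: conj_product_rel.
  - by move=> r rR; exists 1%N; rewrite -[r]mulg1 -[r]mul1g -{1}invg1;
      apply: conj_product_rel; left.
have [N1 NB NJ] := normal_relation_subgroup.
elim/conj_product_ind => // u r v rR Nv.
have NV x : relation_subgroup x -> relation_subgroup x^-1.
  by move=> Nx; rewrite -[x^-1]mul1g; apply: NB.
have NR x : x \in R -> relation_subgroup x by move=> xR N [_]; apply.
rewrite -[v]invgK; apply: NB; last exact: NV.
by rewrite -mulgA; apply: NJ; case: rR => /NR // /NV; rewrite invgK.
Qed.

Lemma areaP w : relation_subgroup w ->
  conj_product w (area w) /\ forall k, conj_product w k -> (area w <= k)%N.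
Proof. by move=> /relation_subgroupP[k /nat_minP]. Qed.

Lemma dehnP n :
  (exists w, [/\ relation_subgroup w, (size w <= n)%N & area w = dehn n]) /\
  (forall w, relation_subgroup w -> (size w <= n)%N -> (area w <= dehn n)%N).
Proof.
pose b := (\max_(l < n.+1) \max_(t : l.-tuple (letter s)) area (fg_of t))%N.
have [||[w [Nw wn] dw] maxd] := @nat_maxP
    [set area w | w in [set w | relation_subgroup w /\ (size w <= n)%N]]
    (area 1) b.
- by exists 1 => //; split=> //; have [] := normal_relation_subgroup.
- move=> _ [w [_ wn] <-].
  have -> : w = fg_of w by apply: val_inj; rewrite /= reduce_id ?fgwordP.
  apply: leq_trans (leq_bigmax (Ordinal (wn : size w < n.+1)%N)) => /=.
  exact: (leq_bigmax (in_tuple w)).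
split=> [|v Nv vn]; first by exists w.
by apply: maxd; exists v.
Qed.

Lemma dehn_homo : {homo dehn : m n / (m <= n)%N}.
Proof.
move=> m n le_mn; have [[w [Nw wm <-]] _] := dehnP m.
by have [_ ->] := dehnP n; last exact: leq_trans le_mn.
Qed.

End DehnFunction.

Definition preceq (f g : nat -> nat) : Prop :=
  exists2 C : nat, (0 < C)%N & forall n, (f n <= C * g (C * n) + C * n)%N.

Module ThompsonT.

Definition x0 : freeGroup 3 := fgen (@Ordinal 3 0 isT).
Definition x1 : freeGroup 3 := fgen (@Ordinal 3 1 isT).
Definition c1 : freeGroup 3 := fgen (@Ordinal 3 2 isT).

(* [x 1] and [c 1] are [x1] and [c1]; the index 0 is not meaningful. *)
Definition x (n : nat) : freeGroup 3 := x0 ^- n.-1 * x1 * x0 ^+ n.-1.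
Definition c (n : nat) : freeGroup 3 := x0 ^- n.-1 * c1 * x1 ^+ n.-1.

Definition relators : seq (freeGroup 3) :=
  [:: x 2 ^ x1 / x 3;
      x 3 ^ x1 / x 4;
      c1 / (x1 * c 2);
      (c 2 * x 2) / (x1 * c 3);
      (c1 * x0) / (c 2 ^+ 2);
      c1 ^+ 3 / 1].

End ThompsonT.

(* Main.v *)
(* Let w have length n. There is a finite binary tree Q with O(n) leaves      *)
(* such that all suffixes of w send Q to trees without any expansion, that is, *)
(* each letter of w acts by a rotation of two or three carets at the root. If  *)
(* V(P) is the usual positive word of F for the tree P and r_k is a word for   *)
(* the rotation of the leaves by k, a letter a turns V(P) r_k into a word      *)
(* V(P') r_l, and the area of this relation is O(n^4). If w is trivial in T,   *)
(* its action on the Cantor set shows that w brings (Q, 0) back to itself, so  *)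
(* w V(Q) = V(Q) is a consequence of relations of total area O(n^5).           *)
(*                                                                             *)
(* The bound O(n^4) rests on a cubic area for x_j x_i = x_i x_(j+1), and more  *)
(* generally for prod_(j<m) x_2^(x_0^j) = prod_(j<m) x_2^(x_1^j). The latter   *)
(* is proved by halving m: x_0^k x_1^-k is a word in x_0 x_1^-1 and its        *)
(* conjugate by x_0^-1, by the reflected instance of the same statement, and   *)
(* these two letters commute with x_2 and x_3. One gets f(m) <= 6 f(m/2) plus  *)
(* a quadratic term. The rotations of the leaves are represented by words of   *)
(* linear length, c_k times a right vine, instead of powers of c_N, so that    *)
(* moving one caret through a rotation also costs O(n^3).                      *)

Require Import Defs.
From mathcomp Require Import all_boot boolp zify.

Set Implicit Arguments.
Unset Strict Implicit.
Unset Printing Implicit Defensive.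

Local Open Scope group_scope.

(** A word w is run on a tree with labelled leaves. Each letter forces at most three extra leaves,
    so [run_exists] gives a tree Q with at most 3|w| + 1 leaves on which all of w acts by local
    moves. [run_eqa] follows the run algebraically: a letter times the word [outer] of the current
    tree becomes the word of the next tree times a rotation of the leaves, and [turns_add] merges
    the rotations. If w is trivial in T it fixes the Cantor set pointwise, so by [find_inj] it
    returns to Q, and the distinct labels exclude a rotation. Cancelling the word of Q gives
    [area_bound].

    One letter may thus cost O(n^4). It moves O(n) carets, so a caret may cost O(n^3). This is what
    [tower_shift] supplies: long products of generators of F equal, at cubic cost, words of linear
    length in two letters, so whatever commutes with x_2 and x_3 commutes cheaply with all later
    generators ([com_xi]). Two places would need about n^2 caret moves if done naively. In [act_c],
    where one subtree must cross two others, the crossed forest is treated as a single element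
    ([shifter]); in [turn_add], rotations are composed through inverses and not from unit
    rotations. *)

(* The library's [gnorm] leaves the operations under distinct coercion paths. *)
Section GroupNormalForm.
Variable G : groupType.
Implicit Types x y z : G.
Lemma grpA x y z : x * (y * z) = x * y * z. Proof. exact: mulgA. Qed.
Lemma grpJ x y : x ^ y = y^-1 * x * y. Proof. by rewrite conjgE mulgA. Qed.
Lemma grpIM x y : (x * y)^-1 = y^-1 * x^-1. Proof. exact: invgM. Qed.
Lemma grpK x y : x * y * y^-1 = x. Proof. exact: mulgK. Qed.
Lemma grpVK x y : x * y^-1 * y = x. Proof. exact: mulgVK. Qed.
Lemma grpII x : x^-1^-1 = x. Proof. exact: invgK. Qed.
Lemma grp1 x : x * 1 = x. Proof. exact: mulg1. Qed.
Lemma grp1l x : 1 * x = x. Proof. exact: mul1g. Qed.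
Lemma grpI1 : 1^-1 = 1 :> G. Proof. exact: invg1. Qed.
Lemma grpxV x : x * x^-1 = 1. Proof. exact: mulgV. Qed.
Lemma grpVx x : x^-1 * x = 1. Proof. exact: mulVg. Qed.
Lemma grpX0 x : x ^+ 0 = 1. Proof. exact: expg0. Qed.
Lemma grpX1 x : x ^+ 1 = x. Proof. exact: expg1. Qed.
Lemma grpXS x n : x ^+ n.+2 = x * x ^+ n.+1. Proof. exact: expgS. Qed.
Lemma jgM x y z : x ^ (y * z) = (x ^ y) ^ z. Proof. exact: conjgM. Qed.
Lemma jMg x y z : (x * y) ^ z = x ^ z * y ^ z. Proof. exact: conjMg. Qed.
Lemma jVg x y : x^-1 ^ y = (x ^ y)^-1. Proof. exact: conjVg. Qed.
Lemma jJg x y z : (x ^ y) ^ z = (x ^ z) ^ (y ^ z). Proof. exact: conjJg. Qed.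
Lemma jXg x y n : (x ^+ n) ^ y = (x ^ y) ^+ n. Proof. exact: conjXg. Qed.
Lemma jg1 x : x ^ 1 = x. Proof. exact: conjg1. Qed.
Lemma j1g x : 1 ^ x = 1 :> G. Proof. exact: conj1g. Qed.
Lemma jgK x y : (x ^ y) ^ y^-1 = x. Proof. exact: conjgK. Qed.
Lemma jgKV x y : (x ^ y^-1) ^ y = x. Proof. exact: conjgKV. Qed.
End GroupNormalForm.

Definition grpE :=
  (grpII, grp1, grp1l, grpI1, grpxV, grpVx, grpK, grpVK, grpIM, grpA, grpX0, grpX1).

Ltac grp := rewrite ?grpJ ?grpE //.

(** * Equality up to area *)

Section Area.
Variables (G : groupType) (R : G -> Prop).
Implicit Types (u v w x y z g h : G) (k l m n : nat).

(** An upper bound for the area: the slack in [Null1] makes it monotone in the bound.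
    [null_conj_product] translates it back. *)
Inductive null : nat -> G -> Prop :=
| Null1 k : null k 1
| NullM k z r w : R r \/ R r^-1 -> null k w -> null k.+1 (r ^ z * w).

Lemma nullW k l w : (k <= l)%N -> null k w -> null l w.
Proof.
move=> lekl nw; elim: nw l lekl => [{}k l _|{}k z r {}w Rr _ IH [//|l]].
  exact: Null1.
by rewrite ltnS => /IH nw; apply: NullM.
Qed.

Lemma nullD k l u v : null k u -> null l v -> null (k + l) (u * v).
Proof.
move=> nu nv; elim: nu => [{}k|{}k z r w Rr _ IH].
  by rewrite mul1g; apply: nullW nv; rewrite leq_addl.
by rewrite -mulgA addSn; apply: NullM.
Qed.

Lemma nullJ k u z : null k u -> null k (u ^ z).
Proof.
elim=> [{}k|{}k y r w Rr _ IH]; first by rewrite j1g; apply: Null1.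
by rewrite jMg -jgM; apply: NullM.
Qed.

Lemma null_rel r z : R r \/ R r^-1 -> null 1 (r ^ z).
Proof. by move=> Rr; rewrite -[_ ^ _]mulg1; apply: NullM => //; apply: Null1. Qed.

Lemma nullV k u : null k u -> null k u^-1.
Proof.
elim=> [{}k|{}k y r w Rr _ IH]; first by rewrite invg1; apply: Null1.
rewrite invgM -jVg -addn1; apply: nullD => //; apply: null_rel.
by rewrite invgK; case: Rr; [right|left].
Qed.

Definition eqa k u v := null k (u / v).

Lemma eqa_le k l u v : eqa k u v -> (k <= l)%N -> eqa l u v.
Proof. by move=> e lekl; apply: nullW e. Qed.

Lemma eqa_refl k u : eqa k u u.
Proof. by rewrite /eqa mulgV; apply: Null1. Qed.

Lemma eqa_eq k u v : u = v -> eqa k u v.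
Proof. by move->; apply: eqa_refl. Qed.

Lemma eqa_sym k u v : eqa k u v -> eqa k v u.
Proof. by move/nullV; rewrite /eqa invgF. Qed.

Lemma eqa_trans k l v u w : eqa k u v -> eqa l v w -> eqa (k + l) u w.
Proof. by move=> uv /(nullD uv); rewrite mulgA grpVK. Qed.

Lemma eqaM k l u u' v v' : eqa k u u' -> eqa l v v' -> eqa (k + l) (u * v) (u' * v').
Proof.
move=> uu vv; rewrite /eqa.
have -> : u * v / (u' * v') = (u / u') * (v / v') ^ u'^-1 by grp.
by apply: nullD => //; apply: nullJ.
Qed.

Lemma eqaMl k u v w : eqa k u v -> eqa k (w * u) (w * v).
Proof. by move/(eqaM (eqa_refl 0 w)). Qed.

Lemma eqaMr k u v w : eqa k u v -> eqa k (u * w) (v * w).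
Proof. by move=> uv; have := eqaM uv (eqa_refl 0 w); rewrite addn0. Qed.

Lemma eqaV k u v : eqa k u v -> eqa k u^-1 v^-1.
Proof.
move=> /eqa_sym/nullJ-/(_ v); congr (null _ _); grp.
Qed.

Lemma eqaJ k u v w : eqa k u v -> eqa k (u ^ w) (v ^ w).
Proof. by move/(nullJ w); rewrite jMg jVg. Qed.

Lemma eqa_rel u v : R (u / v) -> eqa 1 u v.
Proof. by move=> Ruv; rewrite /eqa -[u / v]jg1; apply: null_rel; left. Qed.

Lemma eqaJJ k l u v w z : eqa k u v -> eqa l w z -> eqa (k + 2 * l) (u ^ w) (v ^ z).
Proof.
move=> uv wz; rewrite !grpJ mul2n -addnn addnA [(k + l)%N]addnC.
by exact: eqaM (eqaM (eqaV wz) uv) wz.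
Qed.

Lemma eqaX k n u v : eqa k u v -> eqa (n * k) (u ^+ n) (v ^+ n).
Proof.
move=> uv; elim: n => [|n IH]; first exact: eqa_refl.
by rewrite mulSn !expgS; apply: eqaM.
Qed.

(* With [l] an existential variable, chained uses collect the total cost. *)
Lemma eqa_step k l u v w w' g h :
  eqa k u v -> g = w * u * w' -> eqa l (w * v * w') h -> eqa (k + l) g h.
Proof. by move=> uv -> /(eqa_trans (eqaMr w' (eqaMl w uv))). Qed.

Definition com k u v := eqa k (u * v) (v * u).

Lemma com_le k l u v : com k u v -> (k <= l)%N -> com l u v.
Proof. exact: eqa_le. Qed.

Lemma com_sym k u v : com k u v -> com k v u.
Proof. exact: eqa_sym. Qed.

Lemma com1 k u : com k u 1.
Proof. by apply: eqa_eq; rewrite mulg1 mul1g. Qed.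

Lemma comM k l u v w : com k u v -> com l u w -> com (k + l) u (v * w).
Proof.
move=> uv uw; rewrite /com mulgA.
by apply: eqa_trans (eqaMr w uv) _; rewrite -!mulgA; apply: eqaMl.
Qed.

Lemma comV k u v : com k u v -> com k u v^-1.
Proof.
move=> /eqa_sym/(eqaMr v^-1)/(eqaMl v^-1); congr (eqa _ _ _); grp.
Qed.

Lemma comX k n u v : com k u v -> com (n * k) u (v ^+ n).
Proof.
move=> uv; elim: n => [|n IH]; first exact: com1.
by rewrite expgS mulSn; apply: comM.
Qed.

Lemma comJ k u v w : com k u v -> com k (u ^ w) (v ^ w).
Proof. by move/(eqaJ w); rewrite !jMg. Qed.

Lemma com_conj k l u v w : com k u v -> com l u w -> com (k + 2 * l) u (v ^ w).
Proof.
move=> uv uw; rewrite mul2n -addnn addnCA conjgE.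
by apply: comM; [exact: comV|exact: comM].
Qed.

Lemma com_eqa k l u v w : eqa l v w -> com k u v -> com (k + l.*2) u w.
Proof.
move=> vw uv; rewrite -addnn addnCA addnA -addnA.
apply: eqa_trans (eqaMl u (eqa_sym vw)) _.
exact: eqa_trans uv (eqaMr u vw).
Qed.

Lemma comP k u v : com k u v <-> eqa k (u ^ v) u.
Proof.
split=> [/(eqaMl v^-1)|/(eqaMl v)]; first by rewrite conjgE mulKg.
by rewrite conjgE mulVKg.
Qed.

End Area.

(** * Cubic area in Thompson's group F *)

Section Tower.
Variables (G : groupType).
Implicit Types (u v w x y z g h t : G) (k l m n : nat).

(* The product of the [y ^ (u ^+ j)] for [j < m]. *)
Fixpoint tower u y m := if m is m'.+1 then y * (tower u y m') ^ u else 1.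

Lemma towerD u y k l :
  tower u y (k + l) = tower u y k * (tower u y l) ^ (u ^+ k).
Proof.
elim: k => [|k IH]; first by rewrite expg0 jg1 mul1g.
by rewrite addSn /= IH jMg -jgM -expgSr mulgA.
Qed.

Lemma towerSr u y m : tower u y m.+1 = tower u y m * y ^ (u ^+ m).
Proof. by rewrite -[m.+1]addn1 towerD /= j1g grp1. Qed.

Lemma towerJ u y z m : (tower u y m) ^ z = tower (u ^ z) (y ^ z) m.
Proof. by elim: m => [|m IH] /=; rewrite ?j1g // jMg jJg IH. Qed.

(* Reflecting the interval replaces [(t, x)] by [(t^-1, mirror t x)]. *)
Definition mirror t x := t * x / t / t.

(** Telescoping: the factor of index j is t^(j+1) x t^-(j+2). *)
Lemma tower_mirror t x k :
  tower t^-1 (mirror t x) k = t * x ^+ k * t ^- k.+1.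
Proof.
elim: k => [|k IH]; first by rewrite expg0 expg1 mulg1 mulgV.
by rewrite /= IH [in RHS]expgS [t ^+ _.+2]expgS /mirror; grp.
Qed.

Lemma expg_mirror t x k :
  x ^+ k.+1 * t ^- k.+1 = (t / x)^-1 * tower t^-1 (mirror t x) k.
Proof. by rewrite tower_mirror expgS; grp. Qed.

Variable (R : G -> Prop).
Notation eqa := (eqa R).
Notation com := (com R).

(** Nested conjugation makes the tower a word of linear length: each level adds one [y] and one pair
    u^-1, u. *)
Lemma com_tower i j g u y m :
  com i g u -> com j g y -> com (m * (j + 2 * i)) g (tower u y m).
Proof.
move=> gu gy; elim: m => [|m IH] /=; first exact: com1.
rewrite mulSn -addnA [(2 * i + _)%N]addnC; apply: comM => //.
exact: com_conj.
Qed.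

(* For [t = x_0] and [x = x_1] these are the two relations of Thompson's [F]. *)
Definition fpair K t x := com K (t / x) (x ^ t) /\ com K (t / x) (x ^ (t * t)).

(** Conjugating by t^-2 or t^-3 exchanges, up to inversion, the two sides of each commutation. The
    cost K is unchanged, so [tower_shift] can recurse on the mirrored pair. *)
Lemma fpair_mirror K t x : fpair K t x -> fpair K t^-1 (mirror t x).
Proof.
case=> /com_sym/comV/com_sym/comV h1 /com_sym/comV/com_sym/comV h2; split.
  have := comJ (t ^- 2) h1 => /com_sym; congr (com _ _ _).
    by rewrite /mirror ?grpXS; grp.
  by rewrite /mirror ?grpXS; grp.
have := comJ (t ^- 3) h2 => /com_sym; congr (com _ _ _).
  by rewrite /mirror ?grpXS; grp.
by rewrite /mirror ?grpXS; grp.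
Qed.

Section Pair.
Variables (K : nat) (t x : G).
Hypothesis F : fpair K t x.

Lemma fpair_a0x2 : com K (t / x) (x ^ t). Proof. by case: F. Qed.
Lemma fpair_a0x3 : com K (t / x) ((x ^ t) ^ t).
Proof. by case: F => _; rewrite jgM. Qed.

Lemma fpair_shift : eqa K ((x ^ t) ^ t) ((x ^ t) ^ x).
Proof.
have /comP/(eqaJ x) := com_sym (fpair_a0x2).
have /com_sym/comP/(eqaJ x) := fpair_a0x2.
by rewrite -[X in eqa _ X]jgM grpVK.
Qed.

(** By [fpair_shift], x_4 is x_3 conjugated by x_2, and t / x commutes with both. *)
Lemma fpair_a0x4 : com (5 * K) (t / x) (((x ^ t) ^ t) ^ t).
Proof.
apply: com_le (com_eqa (eqa_sym (eqaJ t fpair_shift)) _) _.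
  by rewrite jJg; exact: com_conj fpair_a0x3 fpair_a0x2.
lia.
Qed.

Lemma mirrorE : mirror t x = ((t / x) ^ t^-1)^-1.
Proof. by rewrite /mirror; grp. Qed.

Lemma fpair_a1x2 : com K (mirror t x) (x ^ t).
Proof.
rewrite mirrorE; apply: com_sym; apply: comV; apply: com_sym.
by have := comJ t^-1 fpair_a0x3; rewrite jgK.
Qed.

Lemma fpair_a1x3 : com (5 * K) (mirror t x) ((x ^ t) ^ t).
Proof.
rewrite mirrorE; apply: com_sym; apply: comV; apply: com_sym.
by have := comJ t^-1 fpair_a0x4; rewrite jgK.
Qed.

End Pair.

Definition cube m := (m * m * m)%N.

(* With [m = k + l], the tail [tower t y l] gets conjugated by [t ^+ k] on one  *)
(* side and by [x ^+ k] on the other. The quotient [x ^+ k / t ^+ k] is, by the *)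
(* mirrored statement for [k.-1], a word in [t / x] and [mirror t x], while the *)
(* tail is a word in [x ^ t] and [(x ^ t) ^ t], and these letters commute.      *)
Lemma tower_shift m K t x : fpair K t x ->
  eqa (21 * K * cube m) (tower t (x ^ t) m) (tower x (x ^ t) m).
Proof.
elim/ltn_ind: m K t x => -[|[|m0]] IH K t x F; first exact: eqa_refl.
  by rewrite /= !j1g; apply: eqa_refl.
have [k' [l' [defm lekl lelk]]] : exists k' l',
    [/\ m0.+2 = k'.+1 + l'.+1, k' <= l' & l' <= k'.+1]%N.
  by exists (m0./2), (uphalf m0); split; lia.
have ltk : (k' < m0.+2)%N by lia.
have ltl : (l' < m0.+2)%N by lia.
have ltk1 : (k'.+1 < m0.+2)%N by lia.
have ltl1 : (l'.+1 < m0.+2)%N by lia.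
set y := x ^ t; set a := t / x; set b := mirror t x.
pose ck := (21 * K * cube k')%N; pose cl := (21 * K * cube l')%N.
(* Conjugated by [t], the mirrored instance trades the conjugator t^-1 for [b ^ t], which is
   [a^-1]. *)
have hA : eqa ck (x ^+ k'.+1 * t ^- k'.+1) (a^-1 * tower a^-1 b k').
  rewrite expg_mirror; apply: eqaMl.
  have := eqaJ t (IH _ ltk _ _ _ (fpair_mirror F)).
  rewrite -/ck -/b !towerJ jgKV; congr (eqa _ (tower _ _ _) (tower _ _ _)).
    by grp.
  by rewrite /b /a /mirror; grp.
have hX : eqa cl (tower t y l'.+1) (y * tower y (y ^ t) l').
  rewrite /=; apply: eqaMl.
  by have := eqaJ t (IH _ ltl _ _ _ F); rewrite [in X in eqa _ _ X]towerJ.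
have hC : com (2 * ck + 2 * cl + 21 * K * (k'.+1 * l'.+1))
              (x ^+ k'.+1 * t ^- k'.+1) (tower t y l'.+1).
  have ca : com (K + l' * (K + 2 * K)) (y * tower y (y ^ t) l') a^-1.
    apply: comV; apply: com_sym; apply: comM; first exact: fpair_a0x2.
    by apply: com_tower; [apply: fpair_a0x2|apply: fpair_a0x3].
  have cb : com (K + l' * (5 * K + 2 * K)) (y * tower y (y ^ t) l') b.
    apply: com_sym; apply: comM; first exact: fpair_a1x2.
    by apply: com_tower; [apply: fpair_a1x2|apply: fpair_a1x3].
  have := comM ca (com_tower k' ca cb).
  move/(com_eqa (eqa_sym hA))/com_sym/(com_eqa (eqa_sym hX)).
  move=> e; apply: com_le e _; nia.
(* The quotient of x^(k'+1) by t^(k'+1) commutes with the tail, so both conjugate it alike;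
   induction then converts the tail itself. *)
have hT : eqa (21 * K * cube l'.+1 + (2 * ck + 2 * cl + 21 * K * (k'.+1 * l'.+1)))
    (tower t y l'.+1 ^ (t ^+ k'.+1)) (tower x y l'.+1 ^ (x ^+ k'.+1)).
  have/com_sym/comP/(eqaJ (t ^+ k'.+1)) := hC.
  rewrite -jgM grpVK => /eqa_sym e.
  have := eqa_trans e (eqaJ (x ^+ k'.+1) (IH _ ltl1 _ _ _ F)).
  by move/eqa_le; apply; rewrite addnC.
rewrite defm !towerD; apply: eqa_le (eqaM (IH _ ltk1 _ _ _ F) hT) _.
rewrite /ck /cl.
(* Six recursive costs at half size make about 6/8 of the cube; the rest pays for the product of the
   two lengths. *)
have : (cube k'.+1 + cube l'.+1 + 2 * cube k' + 2 * cube l' + k'.+1 * l'.+1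
   <= cube (k'.+1 + l'.+1))%N.
  have [->|->] : l' = k' \/ l' = k'.+1 by lia.
    by rewrite /cube; nia.
  by rewrite /cube; nia.
move/(leq_mul (leqnn (21 * K))); apply: leq_trans.
move: (cube k'.+1) (cube l'.+1) (cube k') (cube l') (k'.+1 * l'.+1)%N => *.
lia.
Qed.

End Tower.

Lemma leq_cube m n : (m <= n)%N -> (cube m <= cube n)%N.
Proof. by move=> lemn; rewrite /cube !leq_mul. Qed.

Lemma cube_ge_sqr m : (m * m <= cube m)%N.
Proof. by rewrite /cube; nia. Qed.

Lemma cube_ge m : (m <= cube m)%N.
Proof. by rewrite /cube; nia. Qed.

(** * Commutation and exchange of generators of F at cubic cost *)

Section PairTheory.
Variables (G : groupType) (R : G -> Prop) (t x : G).
Hypothesis F : fpair R 1 t x.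
Notation eqa := (eqa R).
Notation com := (com R).
Implicit Types (u v w y z g h : G) (k l m n : nat).

Let a := t / x.
Let b := mirror t x.

Definition xconj n := x ^ (t ^+ n).

Lemma xconj0 : xconj 0 = x. Proof. by rewrite /xconj expg0 jg1. Qed.
Lemma xconj1 : xconj 1 = x ^ t. Proof. by rewrite /xconj expg1. Qed.
Lemma xconjS n : xconj n.+1 = (xconj n) ^ t.
Proof. by rewrite /xconj expgSr jgM. Qed.
Lemma xconjD m n : xconj (m + n) = (xconj m) ^ (t ^+ n).
Proof. by rewrite /xconj expgnDr jgM. Qed.

Lemma tower_word m :
  eqa (21 * cube m) (tower t (x ^ t) m.+1) (x ^ t * tower (x ^ t) ((x ^ t) ^ t) m).
Proof.
rewrite /=; apply: eqaMl.
by have := eqaJ t (tower_shift m F); rewrite muln1 [in X in eqa _ _ X]towerJ.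
Qed.

Lemma pow_word m :
  eqa (21 * cube m) (x ^+ m.+1 * t ^- m.+1) (a^-1 * tower a^-1 b m).
Proof.
rewrite expg_mirror; apply: eqaMl.
have := eqaJ t (tower_shift m (fpair_mirror F)).
rewrite muln1 -/b !towerJ jgKV; congr (eqa _ (tower _ _ _) (tower _ _ _)).
  by grp.
by rewrite /b /a /mirror; grp.
Qed.

Lemma pow_com m : com (45 * cube m) (x ^ t) (x ^+ m * t ^- m).
Proof.
case: m => [|m]; first by rewrite expg0; grp; apply: com1.
have e1 := com_sym (fpair_a0x2 F); have e2 := com_sym (fpair_a1x2 F).
have := com_eqa (eqa_sym (pow_word m)) (comM (comV e1) (com_tower m (comV e1) e2)).
move/com_le; apply; have := cube_ge m; have := @leq_cube m m.+1 (leqnSn m).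
have := cube_ge m.+1; lia.
Qed.

Lemma shift2 m : eqa (45 * cube m) ((x ^ t) ^ (t ^+ m)) ((x ^ t) ^ (x ^+ m)).
Proof.
have /comP/(eqaJ (t ^+ m))/eqa_sym := pow_com m.
by rewrite -[X in eqa _ _ X]jgM grpVK.
Qed.

Lemma shift3 m :
  eqa (45 * cube m) (xconj (2 + m)) (((x ^ t) ^ t) ^ ((x ^ t) ^+ m)).
Proof.
have := eqaJ t (shift2 m); congr (eqa _ _ _).
  by rewrite -!jgM /xconj -!expgSr -expgS.
by rewrite jJg jXg.
Qed.

(** By [shift3], x_(n+1) is x_3 conjugated by x_2^(n-2+1-1) once n > 1, a word of linear length. The
    cubic term does not depend on [i], and the cost is linear in [i]. *)
Lemma com_xi i g n : com i g (xconj 1) -> com i g (xconj 2) -> (0 < n)%N ->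
  com (2 * n * i + 90 * cube n) g (xconj n).
Proof.
rewrite [xconj 2]xconjS xconj1; case: n => [|[|n]] // h2 h3 _.
  by rewrite xconj1; apply: com_le h2 _; lia.
have /com_eqa := eqa_sym (shift3 n).
move/(_ _ _ (com_conj h3 (comX n h2)))/com_le; apply.
have := @leq_cube n n.+2 (leqW (leqnSn n)); nia.
Qed.

Lemma com_a_xi n : (0 < n)%N -> com (92 * cube n) a (xconj n).
Proof.
move=> n0; have := com_xi _ _ n0 => /(_ 1%N a); rewrite [xconj 2]xconjS xconj1.
move/(_ (fpair_a0x2 F) (fpair_a0x3 F))/com_le; apply.
have := cube_ge n; lia.
Qed.

Lemma com_a_conj k u : com k a u -> eqa k (u ^ t) (u ^ x).
Proof.
move/com_sym/comP/(eqaJ x); rewrite -jgM /a grpVK; exact.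
Qed.

(** The whole block x_2 ... x_(m+1) crosses x_1 at once, as a short word in x_2 and x_3; letter by
    letter this would be quartic. *)
Lemma tower_swap m : eqa (45 * cube m) (tower t (x ^ t) m * x)
  (x * tower t ((x ^ t) ^ t) m).
Proof.
have -> : tower t ((x ^ t) ^ t) m = tower t (x ^ t) m ^ t by rewrite towerJ; grp.
suff /com_a_conj/(eqaMl x)/eqa_sym : com (45 * cube m) a (tower t (x ^ t) m).
  by congr (eqa _ _ _); grp.
case: m => [|m]; first exact: com1.
have e2 := fpair_a0x2 F; have e3 := fpair_a0x3 F.
have := com_eqa (eqa_sym (tower_word m)) (comM e2 (com_tower m e2 e3)).
move/com_le; apply; have := cube_ge m; have := @leq_cube m m.+1 (leqnSn m).
have := cube_ge m.+1; lia.
Qed.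

(* The generators [x_n] of the infinite presentation of [F]. *)
Definition xgen n := if n is m.+1 then xconj m else t.

Lemma XS n : xgen n.+2 = xgen n.+1 ^ t. Proof. exact: xconjS. Qed.
Lemma XD m n : xgen (m.+1 + n) = xgen m.+1 ^ (t ^+ n). Proof. exact: xconjD. Qed.

(** For i > 0, conjugation by a power of [t] reduces to x_1, where t / x commutes with the later
    generators. *)
Lemma X_swap i j M : (i < j)%N -> (j <= M)%N ->
  eqa (92 * cube M) (xgen j * xgen i) (xgen i * xgen j.+1).
Proof.
case: i j => [|i] [|j] // ltij lejM.
  by apply: eqa_eq; rewrite XS /=; grp.
have d0 : (0 < j - i)%N by lia.
have e1 : xconj j = xconj (j - i) ^ (t ^+ i) by rewrite -xconjD; congr xconj; lia.
rewrite /xgen [xconj j.+1]xconjS e1 -[xconj i]/(x ^ (t ^+ i)).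
rewrite -[(_ ^ _) ^ t]jgM -expgSr expgS jgM.
rewrite -!jMg; apply: eqaJ; have := eqaMl x (com_a_conj (com_a_xi d0)).
move/eqa_sym/eqa_le=> /(_ (92 * cube M)%N); rewrite leq_mul ?leq_cube //; last lia.
by move/(_ isT); congr (eqa _ _ _); grp.
Qed.

End PairTheory.

(** * Rotations *)

Inductive tree (L : Type) := Leaf of L | Node of tree L & tree L.

Section Rotations.
Variables (G : groupType) (R : G -> Prop) (t x c : G).
Notation eqa := (eqa R).
Notation com := (com R).
Local Notation X := (xgen t x).
Local Notation xi := (xconj t x).
Implicit Types (u v w y z g h : G) (k l m n : nat).

(* [c_n], where [c_0] is the rotation of the tree with two leaves. *)
Definition rc n := if n is m.+1 then t ^- m * c * x ^+ m else t * c.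

Record Trel : Prop := {
  Trel_pair : fpair R 1 t x;
  Trel_c1 : eqa 1 c (x * rc 2);
  Trel_c2 : eqa 1 (rc 2 * X 2) (x * rc 3);
  Trel_cx0 : eqa 1 (c * t) (rc 2 * rc 2);
  Trel_c3 : eqa 1 (c * c * c) 1 }.

Hypothesis T : Trel.
Let F := Trel_pair T.

Ltac expand := rewrite ?/xgen ?/xconj ?/rc ?grpXS; grp.
Ltac step H w w' := eapply (eqa_step (w:=w) (w':=w') H); [by expand|].
Ltac stop := apply: (@eqa_eq _ _ 0); by expand.

Lemma rcS n : rc n.+2 = t^-1 * rc n.+1 * x.
Proof. by rewrite /rc !expgSr; grp. Qed.

Lemma rc_xS n : rc n.+1 * x = t * rc n.+2.
Proof. by rewrite rcS; grp. Qed.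

Lemma rc_split n : eqa 1 (rc n.+1) (X n.+1 * rc n.+2).
Proof.
have := eqaMr (x ^+ n) (eqaMl (t ^- n) (Trel_c1 T)); congr (eqa _ _ _).
by rewrite /xgen /xconj /rc !(expgS _ n); grp.
Qed.

Lemma rc2_x0 : eqa 4 (rc 2 * t) (rc 3 * rc 3).
Proof.
eapply eqa_le.
  step (eqa_sym (Trel_c1 T)) x^-1 t.
  step (Trel_cx0 T) x^-1 (1 : G).
  step (rc_split 1) (x^-1 * rc 2) (1 : G).
  step (Trel_c2 T) x^-1 (rc 3).
  stop.
by [].
Qed.

Lemma rc3_x3 : eqa 2 (rc 3 * X 3) (X 2 * rc 4).
Proof.
eapply eqa_le.
  step (com_a_conj (fpair_a0x2 F)) (t^-1 * rc 2 * x) (1 : G).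
  step (Trel_c2 T) t^-1 x.
  stop.
by [].
Qed.

Lemma rc3_x0 : eqa 8 (rc 3 * t) (rc 4 * rc 4).
Proof.
eapply eqa_le.
  step (eqa_sym (rc_split 1)) (X 2)^-1 t.
  step rc2_x0 (X 2)^-1 (1 : G).
  step (rc_split 2) ((X 2)^-1 * rc 3) (1 : G).
  step rc3_x3 (X 2)^-1 (rc 4).
  stop.
by [].
Qed.

Lemma rc3_x2 : eqa 4 (rc 3 * X 2) (X 1 * rc 4).
Proof.
eapply eqa_le.
  step (eqa_sym (rc_split 1)) (X 2)^-1 (X 2).
  step (Trel_c2 T) (X 2)^-1 (1 : G).
  step (eqa_sym (eqaV (com_a_conj (fpair_a0x2 F)))) x (rc 3).
  step (rc_split 2) (x * (X 3)^-1) (1 : G).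
  stop.
by [].
Qed.

(** With [conj_c_x3], the seed from which [conj_c_X] obtains the conjugates of all later
    generators. *)
Lemma conj_c_x2 : eqa 11 (c^-1 * X 2 * c) (t * t / x / t).
Proof.
eapply eqa_le.
  step (Trel_cx0 T) (c^-1 * X 2) t^-1.
  step rc2_x0 (c^-1 * X 2) (rc 3 * x^-1 * t^-1).
  step (eqa_sym (rc_split 1)) (c^-1) (rc 3 * rc 3 * x^-1 * t^-1).
  step (eqa_sym rc2_x0) (c^-1 * rc 2) (x^-1 * t^-1).
  step (eqa_sym (Trel_cx0 T)) (c^-1) (t * x^-1 * t^-1).
  stop.
by [].
Qed.

Lemma conj_c_x3 : eqa 31 (c^-1 * X 3 * c) (t * x * x / (t * x * X 2)).
Proof.
eapply eqa_le.
  step (Trel_cx0 T) (c^-1 * X 3) t^-1.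
  step rc3_x2 (c^-1 * X 3 * rc 2 * t) ((X 2)^-1 * x^-1 * t^-1).
  step rc2_x0 (c^-1 * X 3) (x * rc 4 * (X 2)^-1 * x^-1 * t^-1).
  step rc3_x0 (c^-1 * X 3) (rc 4 * rc 4 * (X 2)^-1 * x^-1 * t^-1).
  step (eqa_sym (rc_split 2)) (c^-1) (rc 4 * rc 4 * rc 4 * (X 2)^-1 * x^-1 * t^-1).
  step (eqa_sym rc3_x0) (c^-1 * rc 3) (rc 4 * (X 2)^-1 * x^-1 * t^-1).
  step (eqa_sym rc2_x0) (c^-1) (rc 3 * x * (X 2)^-1 * x^-1 * t^-1).
  step (eqa_sym (Trel_cx0 T)) (c^-1) (x * x * (X 2)^-1 * x^-1 * t^-1).
  stop.
by [].
Qed.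

(** The relations c_1 x_0 = c_2^2 and c_1 = x_1 c_2 turn the square into a conjugate of c_1^3. *)
Lemma rc0_sqr : eqa 5 (rc 0 * rc 0) 1.
Proof.
eapply eqa_le.
  step (Trel_cx0 T) t c.
  step (Trel_cx0 T) (t * rc 2 * rc 2) t^-1.
  step (eqa_sym (Trel_cx0 T)) t (rc 2 * rc 2 * t^-1).
  step (eqa_sym (Trel_c1 T)) (t * c * c) t^-1.
  step (Trel_c3 T) t t^-1.
  stop.
by [].
Qed.

(** * Vines and the conjugates of generators by rotations *)

Fixpoint vine r := if r is r'.+1 then vine r' * X r' else 1.

Lemma vineS r : vine r.+1 = t * tower t x r.
Proof.
elim: r => [|r IH]; first by rewrite /=; grp.
by rewrite -[LHS]/(vine r.+1 * X r.+1) IH towerSr /xgen /xconj; grp.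
Qed.

Lemma tower_pow r : tower t x r = (t / x) ^- r * t ^+ r.
Proof.
elim: r => [|r IH]; first by grp.
by rewrite [LHS]/= IH [in RHS]expgSr [t ^+ r.+1]expgSr; grp.
Qed.

Lemma vineD n s : vine (n.+1 + s) = vine n.+1 * tower t (X n.+1) s.
Proof.
rewrite addSn !vineS towerD towerJ -[X n.+1]/(x ^ (t ^+ n)) mulgA.
by congr (_ * tower _ _ _); rewrite grpJ -grpA -expgS expgSr; grp.
Qed.

(* The conjugate of [x_(q+2)] by [c_1], as an element of [F]. *)
Definition leftgen q := vine q.+1 * X q * (vine q.+2)^-1.

Lemma leftgen0 : leftgen 0 = t * t / x / t.
Proof. by rewrite /leftgen /=; expand. Qed.

Lemma leftgen1 : leftgen 1 = t * x * x / (t * x * X 2).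
Proof. by rewrite /leftgen /=; expand. Qed.

(** An identity at no cost, the image under conjugation by c_1 of x_(e+3) = x_3 conjugated by
    x_2^e. *)
Lemma leftgenS e : leftgen e.+1 = leftgen 1 ^ (leftgen 0 ^+ e).
Proof.
have -> : leftgen 0 ^+ e = ((t / x) ^+ e) ^ t^-1.
  by rewrite jXg leftgen0; congr (_ ^+ _); grp.
have -> : leftgen e.+1 =
    ((x / X 2) ^ (t ^+ e)) ^ (vine e.+2)^-1.
  rewrite /leftgen -[vine e.+3]/(vine e.+2 * X e.+2) jMg jVg.
  by rewrite -[X e.+2]/(xi (1 + e)) xconjD -[X e.+1]/(xi e) -[X 2]/(xi 1); grp.
rewrite vineS tower_pow leftgen1 /=.
rewrite [t ^+ e.+1]expgS [(t / x) ^+ e.+1]expgS.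
by expand.
Qed.

Lemma com_mirror_x : com 1 x (mirror t x).
Proof.
rewrite (mirrorE t x); apply: comV; apply: com_sym.
by have := comJ t^-1 (fpair_a0x2 F); rewrite jgK.
Qed.

Lemma com_leftgen0 : com 1 x (leftgen 0).
Proof.
by have := comV com_mirror_x; rewrite leftgen0 /mirror; congr (com _ _ _); grp.
Qed.

Lemma com_leftgen1 : com 4 x (leftgen 1).
Proof.
have -> : leftgen 1 = ((((t / x) ^ (t ^- 2))^-1 * leftgen 0) ^ leftgen 0).
  by rewrite leftgen1 leftgen0; expand.
apply: (@com_conj _ _ 2 1) com_leftgen0; apply: (@comM _ _ 1 1) com_leftgen0.
apply: comV; apply: com_sym; have := comJ (t ^- 2) (fpair_a0x3 F).
by congr (com _ _ _); expand.
Qed.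

(** Geometrically, x_1 moves only the right half of the interval and [leftgen q] only the left half.
    This absorbs the power of [x] at the end of c_k. *)
Lemma com_leftgen q : com (4 + 2 * q) x (leftgen q).
Proof.
case: q => [|e]; first by apply: com_le com_leftgen0 _.
rewrite leftgenS; apply: com_le (com_conj com_leftgen1 (comX e com_leftgen0)) _.
lia.
Qed.

Lemma conj_c_X q :
  eqa (31 + 22 * q + 45 * cube q) (c^-1 * X q.+2 * c) (leftgen q).
Proof.
case: q => [|e].
  by rewrite leftgen0; apply: eqa_le conj_c_x2 _; lia.
rewrite leftgenS.
have -> : c^-1 * X e.+3 * c = xi (2 + e) ^ c by rewrite grpJ.
have e0 : eqa 11 ((x ^ t) ^ c) (leftgen 0).
  by have := conj_c_x2; rewrite leftgen0; congr (eqa _ _ _); expand.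
have e1 : eqa 31 (((x ^ t) ^ t) ^ c) (leftgen 1).
  by have := conj_c_x3; rewrite leftgen1; congr (eqa _ _ _); expand.
have e2 := eqaJ c (shift3 F e).
have def2 : (((x ^ t) ^ t) ^ ((x ^ t) ^+ e)) ^ c =
   (((x ^ t) ^ t) ^ c) ^ (((x ^ t) ^ c) ^+ e) by rewrite jJg jXg.
rewrite def2 in e2.
apply: eqa_le (eqa_trans e2 (eqaJJ e1 (eqaX e e0))) _.
have := leq_cube (leqnSn e); lia.
Qed.

Lemma conj_rc_X k q :
  eqa (31 + 22 * q + 45 * cube q + k * (4 + 2 * q))
      ((rc k)^-1 * X (k.+1 + q) * rc k) (leftgen q).
Proof.
case: k => [|k].
  rewrite mul0n addn0; have := conj_c_X q; congr (eqa _ _ _).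
  rewrite add1n -[X q.+2]/(xi q.+1) -[X q.+1]/(xi q) xconjS /=.
  by rewrite /rc; grp.
have e1 := eqaJ (x ^+ k) (conj_c_X q).
have /comP e2 := comX k (com_sym (com_leftgen q)).
have e := eqa_trans e1 e2.
have {}e : eqa (31 + 22 * q + 45 * cube q + k * (4 + 2 * q))
     ((rc k.+1)^-1 * X (k.+2 + q) * rc k.+1) (leftgen q).
  move: e; congr (eqa _ _ _).
  have -> : (k.+2 + q = q.+2 + k)%N by lia.
  by rewrite XD; expand.
by apply: eqa_le e _; rewrite mulSn; lia.
Qed.

(** * Cyclic rotations of the leaves *)

Definition cost M := (300 * cube M)%N.

(* The rotation by [k.+1] leaves of a tree with [k + r + 2] leaves. *)
Definition turn k r := (rc k * vine r)^-1.

Lemma turn_split k r : turn k r = X r * turn k r.+1.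
Proof. by rewrite /turn /=; grp. Qed.

Lemma tower_X_swap s q : eqa (45 * cube s) (tower t (X q.+1) s * X q)
                                         (X q * tower t (X q.+2) s).
Proof.
case: q => [|q].
  apply: eqa_eq; rewrite [X 2]XS -[in RHS]/(X 0) -[in LHS]/(X 0) /=.
  by have := towerJ t (xi 0) t s; rewrite [t ^ t]grpJ; grp => <-; grp.
have := eqaJ (t ^+ q) (tower_swap F s).
have tq : t ^ (t ^+ q) = t by rewrite grpJ -grpA -expgS expgSr; grp.
rewrite !jMg !towerJ tq; congr (eqa _ (tower _ _ _ * _) (_ * tower _ _ _)).
  by rewrite /xgen /xconj expgS; grp.
by rewrite /xgen /xconj !expgS; grp.
Qed.

Lemma leftgen_vine q s : eqa (45 * cube s) (leftgen q)
  (vine (q.+1 + s) * X q * (vine (q.+2 + s))^-1).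
Proof.
eapply eqa_le.
  eapply (eqa_step (w := vine q.+1) (w' := (tower t (X q.+2) s)^-1 * (vine q.+2)^-1)
     (eqa_sym (tower_X_swap s q))).
    by rewrite /leftgen; grp.
  by apply: (@eqa_eq _ _ 0); rewrite !vineD; grp.
by rewrite addn0.
Qed.

(** The rotation sends leaf k+1+q to q, leaf k to the last leaf, where a caret costs no letter, and
    leaf j < k to j+1+r. [turnX_ge], [turnX_eq] and [turnX_lt] grow a caret in these three cases. *)
Lemma turnX_ge M k r q : (0 < M)%N -> (k <= M)%N -> (r <= M)%N -> (q < r)%N ->
  eqa (cost M) (turn k r * X (k.+1 + q)) (X q * turn k r.+1).
Proof.
move=> M0 kM rM qr; have defr : (q.+1 + (r - q.+1))%N = r by lia.
have defr1 : (q.+2 + (r - q.+1))%N = r.+1 by lia.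
have e := eqa_trans (conj_rc_X k q) (leftgen_vine q (r - q.+1)).
rewrite defr defr1 in e.
have := eqaMl (vine r)^-1 (eqaMr (rc k)^-1 e).
move/eqa_le=> /(_ (cost M)) H.
have {H}/H : (31 + 22 * q + 45 * cube q + k * (4 + 2 * q)
    + 45 * cube (r - q.+1) <= cost M)%N.
  have := @leq_cube q M; have := @leq_cube (r - q.+1) M.
  have := cube_ge M; have := cube_ge_sqr M; rewrite /cost; nia.
by congr (eqa _ _ _); rewrite /turn; grp.
Qed.

Lemma turnX_eq k r : eqa 1 (turn k r * X k) (turn k.+1 r).
Proof.
case: k => [|k]; first by apply: eqa_eq; rewrite /turn /rc /=; grp.
have := eqaMl (vine r)^-1 (eqaMr (X k.+1) (eqaV (rc_split k))).
by congr (eqa _ _ _); rewrite /turn; grp.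
Qed.

Lemma rc_tower d : eqa d (rc 2) (tower t (X 2) d * rc d.+2).
Proof.
elim: d => [|d IH]; first by apply: eqa_eq; rewrite /=; grp.
have e := eqaMl (tower t (X 2) d) (rc_split d.+1).
apply: (@eqa_le _ _ (d + 1)%N); last by rewrite addn1.
apply: eqa_trans IH _; move: e; congr (eqa _ _ _).
have -> : X d.+2 = X 2 ^ (t ^+ d) by rewrite -[X 2]/(xi 1) -xconjD.
by rewrite [tower _ _ d.+1]towerSr; grp.
Qed.

(** Writing c_2 as x_2 ... x_(d+1) c_(d+2) reduces this to c_2 x_2 = x_1 c_3 and a single
    [tower_swap]. *)
Lemma rc_x2 d : eqa (2 * d + 1 + 45 * cube d) (rc d.+2 * X 2) (X 1 * rc d.+3).
Proof.
have e3 : eqa d (rc 3) (tower t (X 3) d * rc d.+3).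
  have := eqaMr x (eqaMl t^-1 (rc_tower d)); congr (eqa _ _ _).
    by rewrite [rc 3]rcS.
  have -> : tower t (X 3) d = tower t (X 2) d ^ t.
    by rewrite towerJ -XS; congr tower; grp.
  by rewrite [rc d.+3]rcS; grp.
eapply eqa_le.
  eapply (eqa_step (w := (tower t (X 2) d)^-1) (w' := X 2) (eqa_sym (rc_tower d))).
    by grp.
  eapply (eqa_step (w := (tower t (X 2) d)^-1) (w' := 1) (Trel_c2 T)); first by grp.
  eapply (eqa_step (w := (tower t (X 2) d)^-1 * x) (w' := 1) e3); first by grp.
  eapply (eqa_step (w := (tower t (X 2) d)^-1) (w' := rc d.+3) (eqa_sym (tower_swap F d))).
    by rewrite [X 3]XS [X 2]XS [X 1]xconj0; grp.
  by apply: (@eqa_eq _ _ 0); rewrite [X 2]XS [X 1]xconj0; grp.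
lia.
Qed.

Lemma rc_X M k j : (k <= M)%N -> (j < k)%N ->
  eqa (94 * cube M) (rc k * X j.+1) (X j * rc k.+1).
Proof.
case: k j => [|k] [|j] // kM jk.
  by apply: eqa_eq; rewrite [X 1]xconj0 rc_xS.
have [d defk] : exists d, k = (d.+1 + j)%N by exists (k - j.+1)%N; lia.
have e1 : eqa (45 * cube j) (x ^+ j * X j.+2) (X 2 * x ^+ j).
  have := eqaMl (x ^+ j) (shift2 F j).
  by congr (eqa _ _ _); rewrite /xgen /xconj; [rewrite expgS|rewrite expg1]; grp.
have rcj n : rc (n.+1 + j) = t ^- j * rc n.+1 * x ^+ j.
  by rewrite addSn /rc !expgnDr; grp.
eapply eqa_le.
  eapply (eqa_step (w := t ^- j * rc d.+2) (w' := 1) e1).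
    by rewrite defk -[(d.+1 + j).+1]/(d.+2 + j)%N rcj; grp.
  eapply (eqa_step (w := t ^- j) (w' := x ^+ j) (rc_x2 d)); first by grp.
  apply: (@eqa_eq _ _ 0); rewrite defk -[(d.+1 + j).+2]/(d.+3 + j)%N rcj.
  by rewrite [X 1]xconj0 -[X j.+1]/(x ^ (t ^+ j)); grp.
have := @leq_cube j M; have := @leq_cube d M; have := cube_ge M; lia.
Qed.

(** A nonempty vine is exactly t (t/x)^-(r-1) t^(r-1), so one use of [com_xi] crosses all of it. *)
Lemma X_vine M j r : (0 < M)%N -> (r + j <= M)%N ->
  eqa (92 * cube M) (X j.+1 * vine r) (vine r * X (j.+1 + r)).
Proof.
case: r => [|r] M0 rj; first by apply: eqa_eq; rewrite addn0 /=; grp.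
have e : com (2 * j.+1 * r + 90 * cube j.+1) ((t / x) ^- r) (xi j.+1).
  apply: com_xi => //; apply: com_sym; apply: comV; rewrite -[X in com X](muln1 r).
    by apply: comX; apply: com_sym; rewrite xconj1; apply: fpair_a0x2.
  by apply: comX; apply: com_sym; rewrite [xi 2]xconjS xconj1; apply: fpair_a0x3.
have {e} := eqaMr (t ^+ r) (eqaMl t (eqa_sym e)).
move/eqa_le=> /(_ (92 * cube M)%N) H.
have {H}/H : (2 * j.+1 * r + 90 * cube j.+1 <= 92 * cube M)%N.
  have := @leq_cube j.+1 M; have := cube_ge_sqr M; nia.
have -> : (j.+1 + r.+1 = j.+2 + r)%N by lia.
by rewrite vineS tower_pow XD XS -[X j.+1]/(xi j) [xi j.+1]xconjS; congr (eqa _ _ _); grp.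
Qed.

Lemma turnX_lt M k r j : (0 < M)%N -> (k + r <= M)%N -> (j < k)%N ->
  eqa (cost M) (turn k r * X j) (X (j.+1 + r) * turn k.+1 r).
Proof.
move=> M0 krM jk.
have kM : (k <= M)%N by lia.
have rjM : (r + j <= M)%N by lia.
eapply eqa_le.
  eapply (eqa_step (w := (vine r)^-1 / rc k) (w' := (rc k.+1)^-1) (eqa_sym (rc_X kM jk))).
    by rewrite /turn; grp.
  eapply (eqa_step (w := (vine r)^-1) (w' := (vine r)^-1 / rc k.+1) (X_vine M0 rjM)).
    by grp.
  by apply: (@eqa_eq _ _ 0); rewrite /turn; move: (X (j.+1 + r)) (vine r) (rc k.+1) => *; grp.
rewrite /cost; lia.
Qed.

Lemma cost_ge M : (M <= cost M)%N.
Proof. by have := cube_ge M; rewrite /cost; lia. Qed.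

Lemma eqa_inv k u v : eqa k (u * v) 1 -> eqa k v u^-1.
Proof. by move/(eqaMl u^-1); rewrite mulKg mulg1. Qed.

Lemma eqa_inv' k u v : eqa k (u * v) 1 -> eqa k u v^-1.
Proof. by move/(eqaMr v^-1); rewrite mulgK mul1g. Qed.

Lemma rc0_vine m : eqa m (rc 0) (vine m * rc m).
Proof.
elim: m => [|m IH]; first by apply: eqa_eq; rewrite /= mul1g.
rewrite -addn1; apply: eqa_trans IH _; rewrite addn1.
case: m => [|m].
  by apply: eqa_eq; rewrite /rc /vine /xgen; grp.
have := eqaMl (vine m.+1) (rc_split m); congr (eqa _ _ _).
exact: grpA.
Qed.

(** As c_0 is an involution equal to the vine times c_m, the vine cancels. *)
Lemma turn0_rc m : eqa (m + 5) (turn 0 m) (rc m).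
Proof.
rewrite addnC; have e0 : eqa 5 (rc 0)^-1 (rc 0).
  have := eqaMr (rc 0)^-1 rc0_sqr; move/eqa_sym.
  by rewrite mulgK mul1g.
have := eqa_trans (eqaMl (vine m)^-1 e0) (eqaMl (vine m)^-1 (rc0_vine m)).
by congr (eqa _ _ _); rewrite /turn; move: (vine m) (rc 0) (rc m) => *; grp.
Qed.

Lemma turn_inv k r : eqa (k + r + 5) (turn k r * turn r k) 1.
Proof.
elim: k => [|k IH].
  have := eqaMr (turn r 0) (turn0_rc r); congr (eqa _ _ _).
  by rewrite /turn [vine 0]/=; move: (rc r) => *; grp.
apply: (@eqa_le _ _ (1 + (k + r + 5))%N); last by lia.
apply: eqa_trans IH; apply: eqa_sym.
have := eqaMr (turn r k.+1) (turnX_eq k r); congr (eqa _ _ _).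
by rewrite [turn r k]turn_split; move: (X k) (turn _ _) (turn _ _) => *; grp.
Qed.

Lemma turn_add_step M A k l e : (k + l + e + 2 <= M)%N ->
  eqa A (turn k (l.+1 + e) * turn l (k.+1 + e)) (turn (k + l).+1 e) ->
  eqa (A + cost M) (turn k (l.+1 + e.+1) * turn l (k.+1 + e.+1)) (turn (k + l).+1 e.+1).
Proof.
move=> leM; rewrite [(A + _)%N]addnC !addnS => eA.
have M0 : (0 < M)%N by lia.
have kM : (k <= M)%N by lia.
have rM : (l.+1 + e <= M)%N by lia.
have qr : (e < l.+1 + e)%N by lia.
have e1 := eqaMr (turn l (k.+1 + e).+1) (eqa_sym (turnX_ge M0 kM rM qr)).
have e2 : turn k (l.+1 + e) * X (k.+1 + e) * turn l (k.+1 + e).+1 =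
          turn k (l.+1 + e) * turn l (k.+1 + e).
  by rewrite [turn l (k.+1 + e)]turn_split; move: (turn _ _) (turn _ _) (X _) => *; grp.
rewrite e2 in e1; have := eqaMl (X e)^-1 (eqa_trans e1 eA); congr (eqa _ _ _).
  by move: (turn _ _) (turn _ _) (X e) => *; grp.
by rewrite [turn _ e]turn_split; move: (turn _ _) (X e) => *; grp.
Qed.

Lemma turn_add_from M A k l e : (k + l + e + 2 <= M)%N ->
  eqa A (turn k l.+1 * turn l k.+1) (turn (k + l).+1 0) ->
  eqa (A + e * cost M) (turn k (l.+1 + e) * turn l (k.+1 + e)) (turn (k + l).+1 e).
Proof.
elim: e => [|e IH] leM eA; first by rewrite !addn0.
by rewrite mulSnr addnA; apply: turn_add_step; [lia|apply: IH eA; lia].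
Qed.

Lemma turn_add11 : eqa 13 (turn 0 1 * turn 0 1) (turn 1 0).
Proof.
have e1 : eqa 6 (turn 0 1) c.
  by have := turn0_rc 1; congr (eqa _ _ _); rewrite /rc; grp.
have e2 : eqa 1 (c * c) (turn 1 0).
  have := eqaMr c^-1 (Trel_c3 T); congr (eqa _ _ _).
    by grp.
  by rewrite /turn /rc /vine; grp.
exact: eqa_trans (eqaM e1 e1) e2.
Qed.

(** With r the rotation by one leaf, this is r r^-2 = r^-1; the negative powers come from
    [turn_inv]. *)
Lemma turn_add_core M k : (k + 2 <= M)%N ->
  eqa (2 * k + 25 + k * cost M) (turn 0 k.+1 * turn k 1) (turn k.+1 0).
Proof.
move=> leM; have leM1 : (0 + 0 + k + 2 <= M)%N by lia.
have e1 := turn_add_from leM1 turn_add11; rewrite add1n in e1.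
have e2 := eqa_inv (turn_inv 1 k).
have e3 := eqa_inv (turn_inv 0 k.+1).
have := eqa_trans (eqaMl (turn 0 k.+1) (eqa_trans e2 (eqa_sym (eqaV e1)))).
have -> : turn 0 k.+1 * (turn 0 k.+1 * turn 0 k.+1)^-1 = (turn 0 k.+1)^-1 by grp.
by move/(_ _ _ (eqa_sym e3))/eqa_le; apply; lia.
Qed.

(** Let r_i rotate k+l+3 leaves by i. Then r_(l+1) is the inverse of r_(k+2) = r_1 r_(k+1), so
    r_(k+1) r_(l+1) = r_1^-1. The other [e] leaves are grown one at a time, for O(M) caret moves in
    all. *)
Lemma turn_add k l e M : (k + l + e + 2 <= M)%N ->
  eqa (M * cost M) (turn k (l.+1 + e) * turn l (k.+1 + e)) (turn (k + l).+1 e).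
Proof.
move=> leM; have leM1 : (k + 2 <= M)%N by lia.
have leM2 : (0 + k + l + 2 <= M)%N by lia.
have e1 := turn_add_from leM2 (turn_add_core leM1); rewrite add0n add1n in e1.
have e2 := eqa_inv (turn_inv k.+1 l).
have e3 := eqa_inv (turn_inv 0 (k.+1 + l)).
have e4 := eqaMl (turn k l.+1) (eqa_trans e2 (eqa_sym (eqaV e1))).
have e5 : turn k l.+1 * (turn 0 (k.+1 + l) * turn k l.+1)^-1 = (turn 0 (k.+1 + l))^-1.
  by move: (turn _ _) (turn _ _) => *; grp.
rewrite e5 in e4.
have {e1 e2 e3 e4 e5} := turn_add_from leM (eqa_trans e4 (eqa_sym e3)) => /eqa_le; apply.
have := cube_ge M; rewrite /cost; move: (cube M) => C leC.
have : (37 + 4 * k + 2 * l + (k + l + e) * (300 * C) <= M * (300 * C))%N by nia.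
by lia.
Qed.

(* The rotation by [i] leaves of a tree with [S] leaves, for [i < S]. *)
Definition turns S i := if i is i'.+1 then turn i' (S - i.+1) else 1.

Lemma turns0 S : turns S 0 = 1. Proof. by []. Qed.

Lemma turns_add M S i j : (1 < S)%N -> (S <= M)%N -> (i < S)%N -> (j < S)%N ->
  eqa (2 * M * cost M) (turns S i * turns S j) (turns S ((i + j) %% S)).
Proof.
move=> S1 SM; case: i => [|k] iS; case: j => [|l] jS.
- by apply: eqa_eq; rewrite addn0 modn_small // /turns mul1g.
- by apply: eqa_eq; rewrite add0n modn_small // [turns S 0]/turns mul1g.
- by apply: eqa_eq; rewrite addn0 modn_small // [turns S 0]/turns mulg1.
rewrite /turns.
have [lt|le] := ltnP (k.+1 + l.+1) S.
  have [e defS] : exists e, S = (k + l + e + 3)%N.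
    by exists (S - (k + l + 3))%N; lia.
  rewrite modn_small // addSn.
  have -> : (S - k.+2 = l.+1 + e)%N by lia.
  have -> : (S - l.+2 = k.+1 + e)%N by lia.
  have -> : (k + l.+1 = (k + l).+1)%N by lia.
  have -> : (S - (k + l).+3 = e)%N by lia.
  by apply: (@eqa_le _ _ (M * cost M)); [apply: turn_add; lia|nia].
have Mge : (M <= cost M)%N := cost_ge M.
have [eqS|neS] := eqVneq (k.+1 + l.+1)%N S.
  rewrite eqS modnn; have -> : (S - k.+2 = l)%N by lia.
  have -> : (S - l.+2 = k)%N by lia.
  apply: eqa_le (turn_inv k l) _; nia.
have -> : ((k.+1 + l.+1) %% S = (k.+1 + l.+1 - S).-1.+1)%N.
  by rewrite -[X in (X %% S)%N](subnK le) modnDr modn_small; lia.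
set e := (_ - S).-1; set r := (S - k.+2)%N; set s := (S - l.+2)%N.
have -> : (S - e.+2 = (s + r).+1)%N by lia.
have defk : (k = s.+1 + e)%N by lia.
have defl : (l = r.+1 + e)%N by lia.
(* When i + j exceeds S, both rotations are replaced by inverses of the complementary ones, whose
   amounts add up to less than S. *)
have e1 := eqa_inv' (turn_inv k r).
have e2 := eqa_inv' (turn_inv l s).
have leM : (s + r + e + 2 <= M)%N by lia.
have e3 := eqaV (turn_add leM); rewrite -defk -defl in e3.
have e4 := eqa_inv' (turn_inv e (s + r).+1).
apply: (@eqa_le _ _ ((k + r + 5 + (l + s + 5)) + M * cost M + (e + (s + r).+1 + 5))%N).
  apply: eqa_trans (eqa_sym e4); apply: eqa_trans (eqaM e1 e2) _.
  by rewrite -grpIM.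
have kM : (k + r <= M)%N by lia.
have lM : (l + s <= M)%N by lia.
have eM : (e + (s + r).+1 <= M)%N by lia.
have : (8 * M <= cost M)%N by have := cube_ge M; rewrite /cost; lia.
nia.
Qed.

(** * Words of trees *)

Variable L : Type.
Implicit Types (A B : tree L).

Fixpoint carets A := if A is Node B C then (carets B + carets C).+1 else 0.

(* [inner i A] grows [A] out of the leaf [i] of a forest, and [outer i A] grows *)
(* it out of the last leaf, where the carets of the right spine cost no letter. *)
Fixpoint inner i A :=
  if A is Node B C then X i * inner i B * inner (i + (carets B).+1) C else 1.

Fixpoint outer i A :=
  if A is Node B C then inner i B * outer (i + (carets B).+1) C else 1.

Arguments xgen : simpl never.

Variable M : nat.
Hypothesis M0 : (0 < M)%N.
Let U := cost M.

Let U0 : (0 < U)%N. Proof. exact: leq_trans M0 (cost_ge M). Qed.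

Ltac gens := repeat match goal with
  | |- context [xgen t x ?n] => move: (xgen t x n) => ?
  | |- context [turn ?k ?r] => move: (turn k r) => ?
  | |- context [inner ?i ?A] => move: (inner i A) => ?
  | |- context [outer ?i ?A] => move: (outer i A) => ?
  end.
Ltac hop H w w' := eapply (eqa_step (w:=w) (w':=w') H); [by gens; grp|].
Ltac land := apply: (@eqa_eq _ _ 0); by gens; grp.

Lemma turn_inner_ge k r q A : (q < r)%N -> (k + r + carets A <= M)%N ->
  eqa (carets A * U) (turn k r * inner (k.+1 + q) A)
                     (inner q A * turn k (r + carets A)).
Proof.
elim: A r q => [_|B IHB C IHC] r q qr /= leM.
  by apply: eqa_eq; rewrite addn0; gens; grp.
have kM : (k <= M)%N by lia.
have rM : (r <= M)%N by lia.
have qr1 : (q < r.+1)%N by lia.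
have qr2 : (q + (carets B).+1 < r.+1 + carets B)%N by lia.
have leM1 : (k + r.+1 + carets B <= M)%N by lia.
have leM2 : (k + (r.+1 + carets B) + carets C <= M)%N by lia.
have e1 := turnX_ge M0 kM rM qr.
have e2 := IHB _ _ qr1 leM1.
have e3 := IHC _ _ qr2 leM2.
have -> : (k.+1 + q + (carets B).+1 = k.+1 + (q + (carets B).+1))%N by lia.
have -> : (r + (carets B + carets C).+1 = r.+1 + carets B + carets C)%N by lia.
eapply eqa_le.
  hop e1 (1 : G) (inner (k.+1 + q) B * inner (k.+1 + (q + (carets B).+1)) C).
  hop e2 (X q) (inner (k.+1 + (q + (carets B).+1)) C).
  hop e3 (X q * inner q B) (1 : G).
  land.
by rewrite -/U; nia.
Qed.

Lemma turn_inner_lt k r j A : (j < k)%N -> (k + r + carets A <= M)%N ->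
  eqa (carets A * U) (turn k r * inner j A)
                     (inner (j.+1 + r) A * turn (k + carets A) r).
Proof.
elim: A k j => [_|B IHB C IHC] k j jk /= leM.
  by apply: eqa_eq; rewrite addn0; gens; grp.
have krM : (k + r <= M)%N by lia.
have jk1 : (j < k.+1)%N by lia.
have jk2 : (j + (carets B).+1 < k.+1 + carets B)%N by lia.
have leM1 : (k.+1 + r + carets B <= M)%N by lia.
have leM2 : (k.+1 + carets B + r + carets C <= M)%N by lia.
have e1 := turnX_lt M0 krM jk.
have e2 := IHB _ _ jk1 leM1.
have e3 := IHC _ _ jk2 leM2.
have -> : (j.+1 + r + (carets B).+1 = (j + (carets B).+1).+1 + r)%N by lia.
have -> : (k + (carets B + carets C).+1 = k.+1 + carets B + carets C)%N by lia.
eapply eqa_le.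
  hop e1 (1 : G) (inner j B * inner (j + (carets B).+1) C).
  hop e2 (X (j.+1 + r)) (inner (j + (carets B).+1) C).
  hop e3 (X (j.+1 + r) * inner (j.+1 + r) B) (1 : G).
  land.
by rewrite -/U; nia.
Qed.

Lemma turn_inner_eq k r A : (k + r + carets A <= M)%N ->
  eqa (carets A * U) (turn k r * inner k A)
                     (outer (k + r).+1 A * turn (k + carets A) r).
Proof.
elim: A k => [_|B _ C IHC] k /= leM.
  by apply: eqa_eq; rewrite addn0; gens; grp.
have leM1 : (k.+1 + r + carets B <= M)%N by lia.
have leM2 : (k.+1 + carets B + r + carets C <= M)%N by lia.
have e2 := turn_inner_lt (ltnSn k) leM1.
have e3 := IHC _ leM2.
have e4 : (k.+1 + carets B + r = (k + r) + (carets B).+1)%N by lia.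
rewrite e4 in e3.
have -> : (k + (carets B).+1 = k.+1 + carets B)%N by lia.
have -> : (k + (carets B + carets C).+1 = k.+1 + carets B + carets C)%N by lia.
eapply eqa_le.
  hop (turnX_eq k r) (1 : G) (inner k B * inner (k.+1 + carets B) C).
  hop e2 (1 : G) (inner (k.+1 + carets B) C).
  hop e3 (inner (k.+1 + r) B) (1 : G).
  apply: (@eqa_eq _ _ 0).
  by rewrite addSn -addSn; gens; grp.
nia.
Qed.

Lemma turn_outer k r A : (k + r + carets A <= M)%N ->
  eqa (carets A * U) (turn k r * outer (k + r).+1 A)
                     (inner r A * turn k (r + carets A)).
Proof.
elim: A r => [_|B _ C IHC] r /= leM.
  by apply: eqa_eq; rewrite addn0; gens; grp.
have leM1 : (k + r.+1 + carets B <= M)%N by lia.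
have leM2 : (k + (r.+1 + carets B) + carets C <= M)%N by lia.
have e2 := turn_inner_ge (ltnSn r) leM1.
have e3 := IHC _ leM2.
have -> : ((k + r).+1 + (carets B).+1 = (k + (r.+1 + carets B)).+1)%N by lia.
have -> : (r + (carets B).+1 = r.+1 + carets B)%N by lia.
have -> : (r + (carets B + carets C).+1 = r.+1 + carets B + carets C)%N by lia.
rewrite turn_split; eapply eqa_le.
  hop e2 (X r) (outer (k + (r.+1 + carets B)).+1 C).
  hop e3 (X r * inner r B) (1 : G).
  land.
nia.
Qed.

(** The mirrored [shift2] gives a word of linear length in t / x and its mirror, so commuting with
    x_2 and x_3 costs only O(M). *)
Lemma letter_word s i : (i <= s.+1)%N -> (s < M)%N -> exists g,
  [/\ eqa U (t ^+ s * X i * t ^- s.+1) g,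
      com (11 * M) g (xi 1) & com (11 * M) g (xi 2)].
Proof.
case: i => [_ sM|i]; last rewrite ltnS => lis sM.
  exists 1; split; last 2 first.
  - by apply: com_sym; apply: com1.
  - by apply: com_sym; apply: com1.
  by apply: eqa_eq; rewrite /xgen expgSr; grp.
have -> : t ^+ s * X i.+1 * t ^- s.+1 = ((t / x)^-1) ^ (t ^- (s - i)).
  have -> : t ^+ s.+1 = t ^+ (s - i) * (t * t ^+ i).
    by rewrite -expgS -expgnDr; congr (t ^+ _); lia.
  have -> : t ^+ s = t ^+ (s - i) * t ^+ i by rewrite -expgnDr subnK.
  by rewrite /xgen /xconj; grp.
rewrite xconj1 [xi 2]xconjS xconj1.
case defm: (s - i)%N => [|m].
  exists (t / x)^-1; split.
  - by apply: eqa_eq; grp.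
  - apply: com_sym; apply: comV; apply: com_sym.
    by apply: com_le (fpair_a0x2 F) _; lia.
  - apply: com_sym; apply: comV; apply: com_sym.
    by apply: com_le (fpair_a0x3 F) _; lia.
have mM : (m <= M)%N by lia.
exists (mirror t x ^ ((t / x)^-1 ^+ m)); split.
- have := eqaJ t (shift2 (fpair_mirror F) m).
  rewrite jJg jgKV [X in eqa _ _ X]jJg jgKV !jXg.
  have -> : t^-1 ^ t = t^-1 by grp.
  have -> : mirror t x ^ t = (t / x)^-1 by rewrite /mirror; grp.
  move/eqa_le=> /(_ U) H.
  have {}H := H (leq_trans (leq_mul (_ : 45 <= 300)%N (leq_cube mM)) (leqnn _)).
  move: (H isT); congr (eqa _ _ _).
  by rewrite expVgn mirrorE -jVg -jgM -grpIM -expgSr.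
- apply: com_sym.
  apply: com_le (com_conj (com_sym (fpair_a1x2 F)) (comX m (comV (com_sym (fpair_a0x2 F))))) _.
  lia.
- apply: com_sym.
  apply: com_le (com_conj (com_sym (fpair_a1x3 F)) (comX m (comV (com_sym (fpair_a0x3 F))))) _.
  lia.
Qed.

Lemma inner_word s i A : (i <= s.+1)%N -> (s + carets A <= M)%N -> exists g,
  [/\ eqa (carets A * U) (t ^+ s * inner i A * t ^- (s + carets A)) g,
      com (carets A * (11 * M)) g (xi 1) & com (carets A * (11 * M)) g (xi 2)].
Proof.
elim: A s i => [_|B IHB C IHC] s i lis /= leM.
  exists 1; split; last 2 first.
  - by apply: com_sym; apply: com1.
  - by apply: com_sym; apply: com1.
  by apply: eqa_eq; rewrite addn0; grp.
have sM : (s < M)%N by lia.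
have [g1 [e1 c1 d1]] := letter_word lis sM.
have [||g2 [e2 c2 d2]] := IHB s.+1 i; [lia|lia|].
have [||g3 [e3 c3 d3]] := IHC (s.+1 + carets B)%N (i + (carets B).+1)%N; [lia|lia|].
have -> : (s + (carets B + carets C).+1 = s.+1 + carets B + carets C)%N by lia.
exists (g1 * (g2 * g3)); split.
- apply: (@eqa_le _ _ (U + (carets B * U + carets C * U))%N); last by nia.
  move: (eqaM e1 (eqaM e2 e3)); congr (eqa _ _ _).
  by gens; move: (t ^+ s.+1) (t ^+ (s.+1 + _)) (t ^+ (s.+1 + _ + _)) => *; grp.
- apply: com_sym; apply: com_le (comM (com_sym c1) (comM (com_sym c2) (com_sym c3))) _.
  by nia.
- apply: com_sym; apply: com_le (comM (com_sym d1) (comM (com_sym d2) (com_sym d3))) _.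
  by nia.
Qed.

(* Commuting with [xi 1] and [xi 2], [g] commutes with every [X j], [1 < j]. *)
Definition shifter e q := exists g,
  [/\ eqa (e * U) q (g * t ^+ e),
      com (e * (11 * M)) g (xi 1) & com (e * (11 * M)) g (xi 2)].

(** A later generator can now cross the forest as one element g t^e at cubic cost; exchanging all
    pairs of letters would cost O(n^5) per rotation. *)
Lemma shifter_forest A B : ((carets A).+1 + carets B <= M)%N ->
  shifter (carets A + carets B) (inner 0 A * inner (carets A).+1 B).
Proof.
move=> leM; have [||g [e c1 c2]] := @inner_word 0 0 A; [lia|lia|].
have [||h [f d1 d2]] := @inner_word (carets A) (carets A).+1 B; [lia|lia|].
exists (g * h); split.
- have := eqaMr (t ^+ (carets A + carets B)) (eqaM e f); rewrite -mulnDl.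
  congr (eqa _ _ _); rewrite add0n /=.
  by gens; move: (t ^+ carets A) (t ^+ (_ + _)) => *; grp.
- apply: com_sym; apply: com_le (comM (com_sym c1) (com_sym d1)) _.
  by nia.
- apply: com_sym; apply: com_le (comM (com_sym c2) (com_sym d2)) _.
  by nia.
Qed.

Lemma shift_X g e j : (e <= M)%N -> (0 < j)%N -> (j <= M)%N ->
  com (e * (11 * M)) g (xi 1) -> com (e * (11 * M)) g (xi 2) ->
  eqa U (X j.+1 * (g * t ^+ e)) (g * t ^+ e * X (j.+1 + e)).
Proof.
move=> eM j0 jM c1 c2; have c3 := com_xi F c1 c2 j0.
have := eqaMr (t ^+ e) (eqa_sym c3) => /eqa_le-/(_ U) H.
(* Linearity of [com_xi] in its input cost keeps this term at j * e * M, hence cubic. *)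
have {H}/H : (2 * j * (e * (11 * M)) + 90 * cube j <= U)%N.
  have := leq_cube jM; rewrite /U /cost; have : (j * e * M <= cube M)%N.
    by rewrite /cube !leq_mul.
  by lia.
rewrite XD -[X j.+1]/(xi j); congr (eqa _ _ _); grp.
Qed.

Lemma shift_inner g e j A : (e <= M)%N -> (1 < j)%N -> (j + carets A <= M)%N ->
  com (e * (11 * M)) g (xi 1) -> com (e * (11 * M)) g (xi 2) ->
  eqa (carets A * U) (inner j A * (g * t ^+ e)) (g * t ^+ e * inner (j + e) A).
Proof.
move=> eM j1 leM c1 c2; elim: A j j1 leM => [_|B IHB C IHC] j j1 /= leM.
  by apply: eqa_eq; grp.
have lB : (j + carets B <= M)%N by lia.
have lC : (j + (carets B).+1 + carets C <= M)%N by lia.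
have e2 := IHB j j1 lB.
have e3 := IHC (j + (carets B).+1)%N (leq_trans j1 (leq_addr _ _)) lC.
have e1 : eqa U (X j * (g * t ^+ e)) (g * t ^+ e * X (j + e)).
  by case: j j1 leM {lB lC e2 e3} => [|j] // ? ?; apply: shift_X => //; lia.
have -> : (j + e + (carets B).+1 = j + (carets B).+1 + e)%N by lia.
move: e1 e2 e3; move: (g * t ^+ e) => q e1 e2 e3.
eapply eqa_le.
  hop e3 (X j * inner j B) (1 : G).
  hop e2 (X j) (inner (j + (carets B).+1 + e) C).
  hop e1 (1 : G) (inner (j + e) B * inner (j + (carets B).+1 + e) C).
  land.
nia.
Qed.

Lemma shift_outer g e j A : (e <= M)%N -> (1 < j)%N -> (j + carets A <= M)%N ->
  com (e * (11 * M)) g (xi 1) -> com (e * (11 * M)) g (xi 2) ->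
  eqa (carets A * U) (outer j A * (g * t ^+ e)) (g * t ^+ e * outer (j + e) A).
Proof.
move=> eM j1 leM c1 c2; elim: A j j1 leM => [_|B _ C IHC] j j1 /= leM.
  by apply: eqa_eq; grp.
have lC : (j + (carets B).+1 + carets C <= M)%N by lia.
have e3 := IHC (j + (carets B).+1)%N (leq_trans j1 (leq_addr _ _)) lC.
have lejB : (j + carets B <= M)%N by lia.
have e2 := shift_inner eM j1 lejB c1 c2.
have -> : (j + e + (carets B).+1 = j + (carets B).+1 + e)%N by lia.
move: e2 e3; move: (g * t ^+ e) => q e2 e3.
eapply eqa_le.
  hop e3 (inner j B) (1 : G).
  hop e2 (1 : G) (outer (j + (carets B).+1 + e) C).
  land.
nia.
Qed.

Lemma shifter_outer q e j A : (e <= M)%N -> (1 < j)%N -> (j + carets A <= M)%N ->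
  shifter e q ->
  eqa (3 * M * U) (outer j A * q) (q * outer (j + e) A).
Proof.
move=> eM j1 leM [g [eq c1 c2]].
have e1 := eqaMl (outer j A) eq.
have e2 := shift_outer eM j1 leM c1 c2.
have e3 := eqaMr (outer (j + e) A) (eqa_sym eq).
apply: eqa_le (eqa_trans e1 (eqa_trans e2 e3)) _.
nia.
Qed.

Lemma inner_X i j A : (i < j)%N -> (j + carets A <= M)%N ->
  eqa (carets A * U) (X j * inner i A) (inner i A * X (j + carets A)).
Proof.
elim: A i j => [_|B IHB C IHC] i j ltij /= leM.
  by apply: eqa_eq; rewrite addn0; gens; grp.
have jM : (j <= M)%N by lia.
have e1 : eqa U (X j * X i) (X i * X j.+1).
  by apply: eqa_le (X_swap F ltij jM) _; rewrite /U /cost; lia.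
have lB : (j.+1 + carets B <= M)%N by lia.
have lC : (j.+1 + carets B + carets C <= M)%N by lia.
have ltC : (i + (carets B).+1 < j.+1 + carets B)%N by lia.
have e2 := IHB i j.+1 (ltnW ltij : i < j.+1)%N lB.
have e3 := IHC _ _ ltC lC.
have -> : (j + (carets B + carets C).+1 = j.+1 + carets B + carets C)%N by lia.
eapply eqa_le.
  hop e1 (1 : G) (inner i B * inner (i + (carets B).+1) C).
  hop e2 (X i) (inner (i + (carets B).+1) C).
  hop e3 (X i * inner i B) (1 : G).
  land.
nia.
Qed.

Lemma act_x0 A B C :
  t * outer 0 (Node A (Node B C)) = outer 0 (Node (Node A B) C).
Proof.
rewrite /= -[X 0]/t; have -> : (0 + (carets A).+1 + (carets B).+1 =
  0 + (carets A + carets B).+2)%N by clear; lia.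
by gens; grp.
Qed.

Lemma act_x1 A B C D :
  (carets A < M)%N ->
  eqa (M * U) (x * outer 0 (Node A (Node B (Node C D))))
              (outer 0 (Node A (Node (Node B C) D))).
Proof.
move=> leM; have e : eqa (carets A * U) (X 1 * inner 0 A) (inner 0 A * X (1 + carets A)).
  by apply: inner_X; lia.
rewrite /= add0n; have -> : ((carets A).+1 + (carets B).+1 + (carets C).+1 =
  (carets A).+1 + (carets B + carets C).+2)%N by lia.
eapply eqa_le.
  eapply (eqa_step (w := 1) (w' := inner (carets A).+1 B *
    (inner ((carets A).+1 + (carets B).+1) C *
     outer ((carets A).+1 + (carets B + carets C).+2) D)) e).
    by rewrite [X 1]xconj0; gens; grp.
  by apply: (@eqa_eq _ _ 0); rewrite add1n; gens; grp.
nia.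
Qed.

(** c_1 rotates three leaves by one. The subtrees cross it in turn, each enlarging the rotation, and
    [shifter_outer] then moves A behind the forest of B and C. *)
Lemma act_c A B C (S := (carets A + carets B + carets C + 3)%N) :
  (S <= M)%N ->
  eqa (5 * M * U) (c * outer 0 (Node A (Node B C)))
    (outer 0 (Node B (Node C A)) * turns S (carets A).+1).
Proof.
rewrite {}/S => leM; rewrite /= !add0n.
have -> : (carets A + carets B + carets C + 3 - (carets A).+2 =
           1 + carets B + carets C)%N by lia.
have e0 : eqa 6 c (turn 0 1).
  by have := eqa_sym (turn0_rc 1); congr (eqa _ _ _); rewrite /rc; grp.
have e1 : eqa (carets A * U) (turn 0 1 * inner 0 A) (outer 2 A * turn (carets A) 1).
  by apply: (@turn_inner_eq 0 1 A); lia.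
have e2 : eqa (carets B * U) (turn (carets A) 1 * inner (carets A).+1 B)
    (inner 0 B * turn (carets A) (1 + carets B)).
  have := @turn_inner_ge (carets A) 1 0 B isT.
  by rewrite [((carets A).+1 + 0)%N]addn0; apply; lia.
have e3 : eqa (carets C * U)
    (turn (carets A) (1 + carets B) * outer ((carets A).+1 + (carets B).+1) C)
    (inner (carets B).+1 C * turn (carets A) (1 + carets B + carets C)).
  have defi : ((carets A + (1 + carets B)).+1 = (carets A).+1 + (carets B).+1)%N by lia.
  by rewrite -defi; apply: (@turn_outer (carets A) (1 + carets B) C); lia.
have e4 : eqa (3 * M * U) (outer 2 A * (inner 0 B * inner (carets B).+1 C))
    (inner 0 B * inner (carets B).+1 C * outer (2 + (carets B + carets C)) A).
  by apply: shifter_outer; [lia|lia|lia|apply: shifter_forest; lia].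
have -> : ((carets B).+1 + (carets C).+1 = 2 + (carets B + carets C))%N by lia.
eapply eqa_le.
  hop e0 (1 : G) (inner 0 A * (inner (carets A).+1 B *
     outer ((carets A).+1 + (carets B).+1) C)).
  hop e1 (1 : G) (inner (carets A).+1 B * outer ((carets A).+1 + (carets B).+1) C).
  hop e2 (outer 2 A) (outer ((carets A).+1 + (carets B).+1) C).
  hop e3 (outer 2 A * inner 0 B) (1 : G).
  hop e4 (1 : G) (turn (carets A) (1 + carets B + carets C)).
  land.
nia.
Qed.

End Rotations.

(** * Runs of words on labelled trees *)

Section Trees.
Variable L : Type.
Implicit Types (A B C D P Q : tree L).

Fixpoint leaves P := match P with
  | Leaf l => [:: l] | Node A B => leaves A ++ leaves B end.

Lemma size_leaves P : size (leaves P) = (carets P).+1.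
Proof. by elim: P => //= A IHA B IHB; rewrite size_cat IHA IHB; lia. Qed.

Inductive move : nat -> tree L -> tree L -> Prop :=
| Move0 A B C : move 0 (Node A (Node B C)) (Node (Node A B) C)
| Move1 A B C D :
    move 1 (Node A (Node B (Node C D))) (Node A (Node (Node B C) D))
| Move2 A B C : move 2 (Node A (Node B C)) (Node B (Node C A)).

Definition step (a : letter 3) P P' := if a.2 then move a.1 P' P else move a.1 P P'.

(* The last letter acts first. *)
Fixpoint run (w : seq (letter 3)) Q P := if w is a :: v then
  exists P', run v Q P' /\ step a P' P else P = Q.

End Trees.

Section Substitution.
Variables (L L' : Type) (f : L -> tree L').

Fixpoint subst (P : tree L) := match P with
  | Leaf l => f l | Node A B => Node (subst A) (subst B) end.

Lemma leaves_subst P : leaves (subst P) = flatten [seq leaves (f l) | l <- leaves P].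
Proof.
elim: P => [l|A IHA B IHB] /=; first by rewrite cats0.
by rewrite map_cat flatten_cat IHA IHB.
Qed.

Lemma move_subst i P P' : move i P P' -> move i (subst P) (subst P').
Proof. by case=> *; constructor. Qed.

Lemma step_subst a P P' : step a P P' -> step a (subst P) (subst P').
Proof. by rewrite /step; case: a.2; apply: move_subst. Qed.

Lemma run_subst w Q P : run w Q P -> run w (subst Q) (subst P).
Proof.
elim: w P => [|a w IH] P /= => [->//|[P' [/IH r /step_subst s]]].
by exists (subst P').
Qed.

End Substitution.

Section Growth.

Local Notation label := (seq nat).
Implicit Types (P Q : tree label) (pat : tree nat).

(* Every leaf is relabelled, which keeps the labels distinct. *)
Definition graft (l : label) pat (y : label) : tree label :=
  subst (fun i => Leaf (i :: y)) (if y == l then pat else Leaf 0).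

Lemma leaves_graft l pat y :
  leaves (graft l pat y) =
    [seq i :: y | i <- if y == l then leaves pat else [:: 0%N]].
Proof.
by rewrite /graft leaves_subst flatten_map1; case: ifP.
Qed.

Lemma uniq_graft l pat (s : seq label) : uniq (leaves pat) -> uniq s ->
  uniq (flatten [seq leaves (graft l pat y) | y <- s]).
Proof.
move=> up; elim: s => //= y s IH /andP[ys us]; rewrite cat_uniq IH // andbT.
apply/andP; split.
  by rewrite leaves_graft map_inj_uniq => [|i j [//]]; case: ifP.
apply/hasPn=> z /flattenP[_ /mapP[y' y's ->]].
rewrite !leaves_graft => /mapP[i _ ->]; apply/negP => /mapP[j _ [_ eqy]].
by move: ys; rewrite -eqy => /negP[].
Qed.

Lemma size_graft l pat (s : seq label) :
  size (flatten [seq leaves (graft l pat y) | y <- s]) =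
    (size s + (size (leaves pat)).-1 * count_mem l s)%N.
Proof.
elim: s => [|y s IH] /=; first by rewrite muln0.
rewrite size_cat IH leaves_graft size_map size_leaves.
by case: (y == l) => /=; rewrite ?size_leaves; lia.
Qed.

Lemma graft_growth l pat P : uniq (leaves pat) -> uniq (leaves P) ->
  (size (leaves pat) <= 4)%N ->
  uniq (leaves (subst (graft l pat) P)) /\
  (size (leaves (subst (graft l pat) P)) <= size (leaves P) + 3)%N.
Proof.
move=> up uP sp; rewrite leaves_subst uniq_graft // size_graft; split=> //.
by rewrite count_uniq_mem //; case: (l \in _); lia.
Qed.

Local Notation N := (@Node nat).
Local Notation O n := (@Leaf nat n%N).

Lemma step_growth a P : uniq (leaves P) -> exists f : label -> tree label,
  [/\ exists P', step a (subst f P) P', uniq (leaves (subst f P)) &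
      (size (leaves (subst f P)) <= size (leaves P) + 3)%N].
Proof.
move=> uP; suff [l [pat [up sp ex]]] : exists l pat,
    [/\ uniq (leaves pat), (size (leaves pat) <= 4)%N &
        exists P', step a (subst (graft l pat) P) P'].
  by have [u s] := graft_growth l up uP sp; exists (graft l pat).
Ltac take_graft l pat := exists l, pat; split=> //;
  rewrite /= /graft ?eqxx /=; eexists; constructor.
case: a => [[i lti] b]; rewrite /step /=.
have shape0 : exists l pat, [/\ uniq (leaves pat), (size (leaves pat) <= 4)%N &
    exists A B C, subst (graft l pat) P = Node A (Node B C)].
  case: P {uP} => [l|A [l|B C]].
  - exists l, (N (O 0) (N (O 1) (O 2))); split=> //.
    by rewrite /= /graft eqxx /=; do 3!eexists.
  - exists l, (N (O 0) (O 1)); split=> //.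
    by rewrite /= /graft eqxx /=; do 3!eexists.
  (* The shape is already there: a one-leaf pattern only relabels. *)
  - by exists [::], (O 0); split=> //=; do 3!eexists.
case: i b lti => [|[|[|//]]] [] _.
- case: P {uP shape0} => [l|[l|A1 A2] B].
  + take_graft l (N (N (O 0) (O 1)) (O 2)).
  + take_graft l (N (O 0) (O 1)).
  + take_graft (Nil nat) (O 0).
- have [l [pat [up sp [A [B [C eqP]]]]]] := shape0.
  by exists l, pat; split=> //; rewrite eqP; eexists; constructor.
- case: P {uP shape0} => [l|A [l|[l|B1 B2] C]].
  + take_graft l (N (O 0) (N (N (O 1) (O 2)) (O 3))).
  + take_graft l (N (N (O 0) (O 1)) (O 2)).
  + take_graft l (N (O 0) (O 1)).
  + take_graft (Nil nat) (O 0).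
- case: P {uP shape0} => [l|A [l|B [l|C D]]].
  + take_graft l (N (O 0) (N (O 1) (N (O 2) (O 3)))).
  + take_graft l (N (O 0) (N (O 1) (O 2))).
  + take_graft l (N (O 0) (O 1)).
  + take_graft (Nil nat) (O 0).
- have [l [pat [up sp [A [B [C eqP]]]]]] := shape0.
  by exists l, pat; split=> //; rewrite eqP; eexists; constructor.
- have [l [pat [up sp [A [B [C eqP]]]]]] := shape0.
  by exists l, pat; split=> //; rewrite eqP; eexists; constructor.
Qed.

Lemma move_perm (L : eqType) i (P P' : tree L) :
  move i P P' -> perm_eq (leaves P) (leaves P').
Proof. by case=> *; rewrite /= ?catA // -catA perm_catC. Qed.

Lemma run_perm (L : eqType) w (Q P : tree L) :
  run w Q P -> perm_eq (leaves Q) (leaves P).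
Proof.
elim: w P => [|a w IH] P /= => [->//|[P' [/IH pP]]].
rewrite /step; case: a.2 => /move_perm; last exact: perm_trans pP.
by rewrite perm_sym; apply: perm_trans pP.
Qed.

(** Substitution at the leaves carries the earlier run along, so growth demanded by the next letter
    can be made at the start. *)
Lemma run_exists w : exists Q P : tree label,
  [/\ run w Q P, uniq (leaves Q) & (size (leaves Q) <= 3 * size w + 1)%N].
Proof.
elim: w => [|a w [Q [P [rQP uQ sQ]]]].
  by exists (Leaf [::]), (Leaf [::]).
have uP : uniq (leaves P) by rewrite -(perm_uniq (run_perm rQP)).
have [f [[P' aP] ufP sfP]] := step_growth a uP.
have rf := run_subst f rQP; have pf := run_perm rf.
exists (subst f Q), P'; split.
- by exists (subst f P).
- by rewrite (perm_uniq pf).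
- by rewrite (perm_size pf); move: sfP; rewrite -(perm_size (run_perm rQP)) /=; lia.
Qed.

End Growth.

(** * Action on the Cantor set *)

Section Cantor.

Definition stream := nat -> bool.
Implicit Types (s : stream) (b : bool).

Definition scons b s : stream := fun n => if n is m.+1 then s m else b.
Definition stail s : stream := fun n => s n.+1.

Lemma stream_eta s : s = scons (s 0) (stail s).
Proof. by apply/funext => -[]. Qed.

Lemma stream_case (Pr : stream -> Prop) : (forall b s, Pr (scons b s)) -> forall s, Pr s.
Proof. by move=> H s; rewrite [s]stream_eta. Qed.

(** These maps rewrite the address of a leaf before a [move] into its address afterwards
    ([find_move]). *)
Definition act0 s := let r := stail s in
  if s 0 then if r 0 then r else scons false (scons true (stail r))
  else scons false s.
Definition act0V s := let r := stail s in
  if s 0 then scons true s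
  else if r 0 then scons true (scons false (stail r)) else r.

Definition act1 s := if s 0 then scons true (act0 (stail s)) else s.
Definition act1V s := if s 0 then scons true (act0V (stail s)) else s.

Definition act2 s := let r := stail s in
  if s 0 then if r 0 then scons true (scons false (stail r)) else r
  else scons true (scons true r).
Definition act2V s := let r := stail s in
  if s 0 then if r 0 then scons false (stail r) else scons true (scons true (stail r))
  else scons true s.

Definition act_letter (a : letter 3) : stream -> stream :=
  match val a.1, a.2 with
  | 0, false => act0 | 0, true => act0V
  | 1, false => act1 | 1, true => act1V
  | _, false => act2 | _, true => act2V
  end.

Ltac split_stream s n :=
  match n with
  | 0 => idtac
  | S ?m => let b := fresh "b" in
     elim/stream_case: s => b s; split_stream s m
  end.
Ltac bits := repeat match goal with b : bool |- _ => case: b end.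

Lemma act_letterK a : cancel (act_letter a) (act_letter (linv a)).
Proof.
by case: a => [[[|[|[|//]]] i] []] s; split_stream s 3; bits.
Qed.

Definition act_word (w : seq (letter 3)) s := foldr act_letter s w.

Lemma act_reduce w s : act_word (reduce w) s = act_word w s.
Proof.
elim: w s => //= a w IH s; rewrite -IH; case: (reduce w) => //= b v.
case: eqP => // ->.
by have := act_letterK (linv a); rewrite linvK => ->.
Qed.

Definition act (g : freeGroup 3) s := act_word g s.

Lemma actM g h s : act (g * h) s = act g (act h s).
Proof. by rewrite /act act_reduce /act_word foldr_cat. Qed.

Lemma actK g : cancel (act g) (act g^-1).
Proof. by move=> s; rewrite -actM mulVg. Qed.

Lemma actVK g : cancel (act g^-1) (act g).
Proof. by move=> s; rewrite -actM mulgV. Qed.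

Lemma act_relator r : r \in ThompsonT.relators -> forall s, act r s = s.
Proof.
rewrite !inE => H s; move: H.
(* Six leading bits decide every branch taken by every relator. *)
split_stream s 6.
do ![case/orP]; move/eqP->; bits; vm_compute; reflexivity.
Qed.
Lemma act_relation g : relation_subgroup ThompsonT.relators g -> forall s, act g s = s.
Proof.
case/relation_subgroupP=> k; elim/conj_product_ind=> // u r v rR IH s.
rewrite 3!actM IH; suff -> : act r (act u s) = act u s by apply: actK.
case: rR => /act_relator // H; by rewrite -{1}[act u s]H actVK.
Qed.

Variable L : eqType.
Implicit Types (P Q : tree L).

Fixpoint find P s := match P with
  | Leaf l => l
  | Node A B => if s 0 then find B (stail s) else find A (stail s) end.

Lemma find_leaves P s : find P s \in leaves P.
Proof.
elim: P s => [l|A IHA B IHB] s /=; first by rewrite inE.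
by rewrite mem_cat; case: (s 0); rewrite ?IHA ?IHB ?orbT.
Qed.

Lemma find_move (i : 'I_3) P P' s :
  move i P P' -> find P' (act_letter (i, false) s) = find P s.
Proof.
move Di: (nat_of_ord i) => j m; move: Di.
by case: m => [A B C|A B C D|A B C] Di; rewrite /act_letter [val _]Di /=;
  split_stream s 3; bits.
Qed.

Lemma find_step a P P' s : step a P P' -> find P' (act_letter a s) = find P s.
Proof.
case: a => i []; rewrite /step /= => /find_move; last exact.
by move/(_ (act_letter (i, true) s)); rewrite (act_letterK (i, true)) => ->.
Qed.

Lemma find_run w Q P s : run w Q P -> find P (act_word w s) = find Q s.
Proof.
elim: w P => [|a w IH] P /= => [->//|[P' [/IH <- /find_step ->//]]].
Qed.

(** A tree with a caret and distinct labels is not constant on streams: the all-false and all-true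
    paths end in different halves. *)
Lemma find_inj P Q : uniq (leaves P) -> uniq (leaves Q) ->
  (forall s, find P s = find Q s) -> P = Q.
Proof.
have split_find A B l : uniq (leaves (Node A B)) -> ~ forall s, find (Node A B) s = l.
  rewrite /= cat_uniq => /and3P[_ /hasPn disj _] H.
  have /disj/negP[] : l \in leaves B by rewrite -(H (fun=> true)) find_leaves.
  by rewrite -(H (fun=> false)) find_leaves.
elim: P Q => [l|A IHA B IHB] [l'|A' B'] uP uQ H.
- by have /= -> := H (fun=> true).
- by case: (split_find _ _ _ uQ (fun s => esym (H s))).
- by case: (split_find _ _ _ uP H).
move: uP uQ; rewrite /= !cat_uniq => /and3P[uA _ uB] /and3P[uA' _ uB'].
congr Node; [apply: IHA|apply: IHB] => // s.
  exact: (H (scons false s)).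
exact: (H (scons true s)).
Qed.

End Cantor.

(** * Area of a run *)

Section Cost.
Import ThompsonT.
Variable L : eqType.
Implicit Types (P Q : tree L).

Let Rel (r : freeGroup 3) : Prop := r \in relators.
Notation eqa := (eqa Rel).
Notation turns := (turns x0 x1 c1).
Notation outer := (outer x0 x1 0).

Lemma xE n : x n.+1 = xgen x0 x1 n.+1.
Proof. by rewrite /x /xgen /xconj /=; grp. Qed.

Lemma Trel_T : Trel Rel x0 x1 c1.
Proof.
have rel1 u v : u / v \in relators -> eqa 1 u v by apply: eqa_rel.
(* Conjugation by x_0 and by x_1 agree on x_(n+2), so x_0 x_1^-1 commutes with it. *)
have pairP n : x n.+3 = x n.+2 ^ x0 -> x n.+2 ^ x1 / x n.+3 \in relators ->
    com Rel 1 (x0 / x1) (x n.+2).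
  move=> eqx /rel1/eqa_sym; rewrite eqx => /(eqaJ x1^-1).
  by rewrite jgK -jgM => /comP/com_sym.
have rel n : (n < 6)%N -> nth 1 relators n \in relators.
  by move=> lt6; apply: (mem_nth (s := relators) 1 lt6).
split.
- split.
  + have := pairP 0 _ (rel 0 isT); rewrite !xE [xgen _ _ 2]XS [xgen _ _ 1]xconj0.
    by apply; exact: XS.
  + have := pairP 1%N _ (rel 1%N isT).
    rewrite !xE [xgen _ _ 3]XS [xgen _ _ 2]XS [xgen _ _ 1]xconj0 jgM; apply; exact: XS.
- exact: rel1 (rel 2 isT).
- exact: rel1 (rel 3 isT).
- exact: rel1 (rel 4 isT).
- exact: rel1 (rel 5 isT).
Qed.

Definition letter_val (a : letter 3) : freeGroup 3 :=
  if a.2 then (fgen a.1)^-1 else fgen a.1.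

Lemma fg_of_cons a w : fg_of (a :: w) = letter_val a * fg_of w.
Proof.
have -> : letter_val a = fg_of [:: a] by case: a => i []; apply: val_inj.
apply: val_inj; change (reduce (a :: w) = reduce (reduce [:: a] ++ reduce w)).
by rewrite reduce_catl reduce_catr.
Qed.

Lemma carets_move i P P' : move i P P' -> carets P' = carets P.
Proof. by case=> *; rewrite /=; lia. Qed.

Lemma carets_step a P P' : step a P P' -> carets P' = carets P.
Proof. by rewrite /step; case: a.2 => /carets_move. Qed.

Lemma carets_run w Q P : run w Q P -> carets P = carets Q.
Proof.
by elim: w P => [|a w IH] P /= => [->//|[P' [/IH <- /carets_step]]].
Qed.

Lemma fgenE (i : 'I_3) n (lt_n : (n < 3)%N) : i = n :> nat -> fgen i = fgen (Ordinal lt_n).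
Proof. by move=> e; congr fgen; apply: val_inj. Qed.

Section Steps.
Variables (M S : nat).
Hypothesis SM : (S <= M)%N.
Let U := (M * cost M)%N.

Lemma move_eqa (i : 'I_3) P P' : carets P = S.-1 -> (0 < S)%N -> move i P P' ->
  (1 < S)%N /\ exists2 k, (k < S)%N & leaves P' = rot k (leaves P) /\
    eqa (5 * U) (fgen i * outer P) (outer P' * turns S k).
Proof.
move=> cP S0 m; have M0 : (0 < M)%N by lia.
move Di: (nat_of_ord i) m => j m; case: m Di cP => [A B C|A B C D|A B C] Di cP.
- move: (cP) => /= cP'; split; first by lia.
  exists 0%N => //; split; first by rewrite rot0 /= catA.
  by rewrite (@fgenE i 0%N isT Di) turns0 mulg1; apply: eqa_eq; apply: act_x0.
- move: (cP) => /= cP'; split; first by lia.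
  exists 0%N => //; split; first by rewrite rot0 /= !catA.
  rewrite (@fgenE i 1%N isT Di) turns0 mulg1.
  have AM : (carets A < M)%N by lia.
  by apply: eqa_le (act_x1 Trel_T M0 B C D AM) _; rewrite /U; lia.
move: (cP) => /= cP'; split; first by lia.
exists (carets A).+1; first by lia.
split; first by rewrite -size_leaves /= rot_size_cat catA.
have defS : S = (carets A + carets B + carets C + 3)%N by lia.
have := act_c Trel_T M0 (A := A) (B := B) (C := C).
by rewrite -defS (@fgenE i 2%N isT Di) /U mulnA; apply.
Qed.

Lemma turns_inv k : (1 < S)%N -> (0 < k)%N -> (k < S)%N ->
  eqa (2 * U) (turns S k)^-1 (turns S (S - k)).
Proof.
move=> S1 k0 kS; apply: eqa_sym; apply: eqa_inv.
have kS' : (S - k < S)%N by lia.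
have := turns_add Trel_T S1 SM kS kS'.
by rewrite subnKC ?modnn 1?ltnW // /U mulnA.
Qed.

(** An inverse letter leaves an inverse rotation; [turns_inv] makes it a rotation again for 2U
    more. *)
Lemma step_eqa a P P' : carets P = S.-1 -> (0 < S)%N -> step a P P' ->
  (1 < S)%N /\ exists2 k, (k < S)%N & leaves P' = rot k (leaves P) /\
    eqa (7 * U) (letter_val a * outer P) (outer P' * turns S k).
Proof.
move=> cP S0 sP; have cP' : carets P' = S.-1 by rewrite (carets_step sP).
case: a sP => i []; rewrite /step /letter_val /= => m; last first.
  have [S1 [k kS [lP e]]] := move_eqa cP S0 m; split=> //.
  by exists k => //; split=> //; apply: eqa_le e _; lia.
have [S1 [k kS [lP e]]] := move_eqa cP' S0 m; split=> //.
have e' : eqa (5 * U) ((fgen i)^-1 * outer P) (outer P' / turns S k).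
  have := eqaMr (turns S k)^-1 (eqaMl (fgen i)^-1 (eqa_sym e)).
  by congr (eqa _ _ _); move: (outer P) (outer P') (turns S k) (fgen i) => *; grp.
have sP : size (leaves P) = S by rewrite size_leaves cP; lia.
case: k kS lP e' {e} => [|k] kS lP e'.
  exists 0%N => //; rewrite lP !rot0; split=> //; apply: eqa_le (_ : eqa (5 * U) _ _) _.
    by move: e'; rewrite turns0 invg1.
  lia.
exists (S - k.+1)%N; first by lia.
split; first by rewrite -sP -[rot _ _]/(rotr k.+1 (leaves P)) lP rotK.
have := eqa_trans e' (eqaMl (outer P') (turns_inv S1 (ltn0Sn k) kS)).
by move/eqa_le; apply; lia.
Qed.

(** Per letter, 7U pays for the step and 2U for merging its rotation with the accumulated one. *)
Lemma run_eqa w Q P : carets Q = S.-1 -> (0 < S)%N -> run w Q P ->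
  exists2 k, (k < S)%N & leaves P = rot k (leaves Q) /\
    eqa (size w * (9 * U)) (fg_of w * outer Q) (outer P * turns S k).
Proof.
move=> cQ S0; elim: w P => [|a w IH] P /= => [->|[P' [r sP]]].
  exists 0%N => //; rewrite rot0; split=> //; apply: eqa_eq.
  by rewrite turns0 mulg1 -[fg_of [::]]/(1 : freeGroup 3) mul1g.
have [k kS [lP' e]] := IH _ r.
have [S1 [l lS [lP f]]] := step_eqa (etrans (carets_run r) cQ) S0 sP.
have sQ : size (leaves Q) = S by rewrite size_leaves cQ; lia.
exists ((l + k) %% S)%N; first by rewrite ltn_mod.
split.
  have lS' := ltnW lS; have kS' := ltnW kS.
  rewrite lP lP' rot_add_mod ?sQ //; have [le|lt] := leqP (l + k) S.
    move: le; rewrite leq_eqVlt => /orP[/eqP lkS|lt]; last by rewrite modn_small.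
    by rewrite lkS modnn rot0 -sQ rot_size.
  by rewrite -{2}(subnK (ltnW lt)) modnDr modn_small //; lia.
have e1 := turns_add Trel_T S1 SM lS kS.
have := eqaMl (letter_val a) e; have := eqaMr (turns S k) f.
have := eqaMl (outer P) e1.
rewrite fg_of_cons !mulgA => e2 e3 e4.
apply: eqa_le (eqa_trans e4 (eqa_trans e3 e2)) _.
by rewrite /U; lia.
Qed.

End Steps.

End Cost.

(** * From a closed run to the Dehn function *)

Lemma rot_uniq_id (L : eqType) (s : seq L) k :
  uniq s -> (k < size s)%N -> rot k s = s -> k = 0%N.
Proof.
case: s => // y s us ks rks; apply/eqP.
rewrite -(nth_uniq y ks (ltn0Sn _) us) -{2}rks /rot nth_cat size_drop subn_gt0 ks.
by rewrite nth_drop addn0.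
Qed.

Lemma null_conj_product s (R : seq (freeGroup s)) k w :
  null (fun r => r \in R) k w -> exists2 j, (j <= k)%N & conj_product R w j.
Proof.
elim=> [{}k|{}k z r {}w Rr _ [j lejk wj]].
  by exists 0%N => //; apply: conj_product1.
exists (1 + j)%N => //; apply: conj_productM wj.
by rewrite grpJ; apply: conj_product_rel.
Qed.

Lemma fg_of_val s (w : freeGroup s) : fg_of w = w.
Proof. by apply: val_inj; rewrite /= reduce_id ?fgwordP. Qed.

Lemma area_bound (w : freeGroup 3) : relation_subgroup ThompsonT.relators w ->
  (area ThompsonT.relators w <= size w * (9 * (4 * size w * cost (4 * size w))))%N.
Proof.
move=> Nw; have [w0|w0] := posnP (size w).
  have [_ minw] := areaP Nw; apply: leq_trans (minw 0%N _) _ => //.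
  by have -> : w = 1 by [apply: val_inj; apply: size0nil]; apply: conj_product1.
have [Q [P [rQP uQ sQ]]] := run_exists w.
have PQ : P = Q.
  apply: find_inj => [||s]; first by rewrite -(perm_uniq (run_perm rQP)).
    exact: uQ.
  by rewrite -(find_run _ rQP) -[in LHS](act_relation Nw s) -/(act w _) act_relation.
rewrite {P}PQ in rQP *.
have S0 : (0 < size (leaves Q))%N by rewrite size_leaves.
have cQ : carets Q = (size (leaves Q)).-1 by rewrite size_leaves.
have [k kS [eqk e]] := run_eqa sQ cQ S0 rQP.
(* Distinct labels leave only the trivial rotation, so the word of Q cancels. *)
rewrite (rot_uniq_id uQ kS (esym eqk)) [turns _ _ _ _ _]/(1 : freeGroup 3) in e.
move: e; rewrite fg_of_val mulg1 /eqa mulgK => /null_conj_product[j lej wj].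
have [_ /(_ j wj)/leq_trans-> //] := areaP Nw; apply: leq_trans lej _.
have le4 : (3 * size w + 1 <= 4 * size w)%N by lia.
by rewrite !leq_mul // /cost leq_mul ?leq_cube.
Qed.

Theorem theorem1p1 :
  preceq (dehn ThompsonT.relators) (fun n => (n ^ 5)%N).
Proof.
exists (9 * (4 * cost 4))%N => [|n]; first by rewrite !muln_gt0.
have [[w [Nw wn <-]] _] := dehnP ThompsonT.relators n.
apply: leq_trans (area_bound Nw) _; apply: leq_trans (leq_addr _ _).
set C := (9 * (4 * cost 4))%N.
have -> : (size w * (9 * (4 * size w * cost (4 * size w))) = C * size w ^ 5)%N.
  by rewrite /C /cost /cube !expnS expn0; lia.
have C0 : (0 < C)%N by rewrite !muln_gt0.
clearbody C; rewrite leq_mul // leq_exp2r //; apply: leq_trans wn _.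
by rewrite leq_pmull.
Qed.
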